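(* Let $K\subset\mathbb{R}^2$ be a bounded closed convex set with positive Lebesgue measure in $\mathbb{R}^2$, and let $f=\chi_K$ denote the corresponding indicator function. Then $$\frac{2}{\pi}\,|f|_{\mathrm{TV}}\le\|Rf\|_{\mathrm{RTV}}\le|f|_{\mathrm{TV}}.$$
   Context: The Radon transform in $\mathbb{R}^2$ is $Rf(\sigma,\theta)=\int_{x\cdot\theta=\sigma}f(x)\,dx$ (integration over lines), $(\sigma,\theta)\in\mathbb{R}\times S^1$. The total variation seminorm on $\mathbb{R}^n$ is $$|f|_{\mathrm{TV}}=\sup\left\{\int_{\mathbb{R}^n}f(x)\,\mathrm{div}\,\phi(x)\,dx:\ \phi\in[C_0^\infty(\mathbb{R}^n)]^n,\ |\phi(\cdot)|\le1\right\}.$$ For $g:\mathbb{R}\times S^{1}\to\mathbb{R}$, $\|g\|_{\mathrm{RTV}}=\sup_{\theta\in S^{1}}|g(\cdot,\theta)|_{\mathrm{TV}}$, where $|g(\cdot,\theta)|_{\mathrm{TV}}$ is the one-dimensional total variation with respect to the offset variable $\sigma$. *)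

(* Defs.v *)
From mathcomp Require Export all_boot all_order all_algebra.
From mathcomp Require Export all_classical all_reals all_analysis.
Export numFieldNormedType.Exports.

Set Implicit Arguments.
Unset Strict Implicit.
Unset Printing Implicit Defensive.

Import Order.TTheory GRing.Theory Num.Theory.

Local Open Scope classical_set_scope.
Local Open Scope ring_scope.

(* The plane is the product [R * R]. Its topology is the Euclidean one, but the
   library norm on it is the max norm, hence the separate Euclidean norm. *)
Definition enorm (R : realType) (x : R * R) : R :=
  Num.sqrt (x.1 ^+ 2 + x.2 ^+ 2).

Definition circle (R : realType) : set (R * R) :=
  [set theta | enorm theta = 1].

Definition lebesgue2 (R : realType) :=
  (@lebesgue_measure R \x @lebesgue_measure R)%E.

(* [E] lists the coordinate vectors: [Ck E k f] says that all the iterated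
   partial derivatives of [f] of order at most [k] exist and are continuous. *)
Fixpoint Ck (R : realType) (V : normedModType R) (E : seq V) (k : nat)
    (f : V -> R) : Prop :=
  continuous f /\
  if k is k'.+1 then
    forall e, e \in E -> (forall x, derivable f x e) /\ Ck E k' ('D_e f)
  else True.

Definition test_function (R : realType) (V : normedModType R) (E : seq V)
    (f : V -> R) : Prop :=
  (forall k, Ck E k f) /\ compact (closure [set x | f x != 0]).

Definition test1 (R : realType) (phi : R -> R) : Prop :=
  @test_function R R [:: 1] phi.

Definition e1 (R : realType) : R * R := (1, 0).
Definition e2 (R : realType) : R * R := (0, 1).

Definition test2 (R : realType) (phi : R * R -> R * R) : Prop :=
  test_function [:: e1 R; e2 R] (fst \o phi) /\
  test_function [:: e1 R; e2 R] (snd \o phi).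

Definition divergence (R : realType) (phi : R * R -> R * R) (x : R * R) : R :=
  'D_(e1 R) (fst \o phi) x + 'D_(e2 R) (snd \o phi) x.

Definition tv1 (R : realType) (f : R -> R) : \bar R :=
  ereal_sup [set (\int[@lebesgue_measure R]_x (f x * 'D_1 phi x)%:E)%E |
             phi in [set phi | test1 phi /\ forall x, `|phi x| <= 1]].

Definition tv2 (R : realType) (f : R * R -> R) : \bar R :=
  ereal_sup [set (\int[@lebesgue2 R]_x (f x * divergence phi x)%:E)%E |
             phi in [set phi | test2 phi /\ forall x, enorm (phi x) <= 1]].

(* For [theta] on the circle, the line x . theta = sigma is parametrized by
   arc length as t |-> sigma theta + t theta^perp. *)
Definition radon (R : realType) (f : R * R -> R) (sigma : R) (theta : R * R)
    : R :=
  \int[@lebesgue_measure R]_t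
    f (sigma *: theta + t *: (- theta.2, theta.1)).

(* [g] is total in its second argument, but only its values on the circle
   are used. *)
Definition rtv (R : realType) (g : R -> R * R -> R) : \bar R :=
  ereal_sup [set tv1 (g^~ theta) | theta in @circle R].

(* Main.v *)
From HB Require Import structures.
Require Import Defs.
From mathcomp Require Import measurable_realfun ring lra.

(** Write [D] for the diameter of [K]. The total variation of the indicator of
    [K] is its perimeter, and the Radon transform of the indicator in a direction
    [theta] is the length of the chord of [K] as a function of the offset. This
    function is concave on its support, so its variation is twice its maximum
    and the supremum over all directions is [2 D]. The claim thus amounts to
    [2 D <= perimeter <= pi D]. Both inequalities are obtained directly from the
    definition of the variations by test functions.

    Right inequality. A test function [phi] on the line gives the plane wave
    [phi (x . theta) theta], whose divergence is [phi' (x . theta)]. Integrating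
    over the lines orthogonal to [theta] (Fubini in rotated coordinates,
    [integral_rot], from the invariance of the area under rotations,
    [area_preserving_rot]) gives exactly the pairing of the chord function with
    [phi']. The wave is cut off along its fronts, which leaves its divergence
    unchanged on [K] ([tv1_chord_le_tv2]).

    Left inequality. For two points [x] and [y] of [K], take [theta] orthogonal
    to [x - y]. As [K] has positive area, it has a point [z] off the line through
    [x] and [y], and by convexity the chords parallel to this line and slightly
    displaced towards [z] are almost as long as the distance from [x] to [y]. A
    test function that jumps from -1 to 1 there shows that the variation of the
    Radon transform is at least twice this distance ([diameter_le_rtv]).

    It remains to bound the integral over [K] of the divergence of a field [Phi]
    of length at most 1 by [pi D] ([tv2_indic_le]). On a line, the integral of a
    derivative of [psi] over [K] is a difference of two values of [psi], and the
    lines of one direction meeting [K] form a band of width at most [D]; thus the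
    integral over [K] of a directional derivative of [psi] is at most [2 D] times
    the supremum of [psi] ([directional_integral_le]). Apply this to signed sums
    of nonnegative functions [W i] with coefficients the lengths of vectors [u i],
    where the sum of the [|u i| W i] is at most [M]. With [a i] the integral over
    [K] of the gradient of [W i], this bounds the sum of
    [|u i| |theta . a i|] by [2 D M] for every unit vector [theta]. The mean of
    [|theta . a|] over all directions is [2 / pi] times [|a|], so the sum of the
    [|u i| |a i|], hence of the [u i . a i], is at most [pi D M]
    ([crofton_sum]). This is the divergence bound for the field which is the sum
    of the [W i u i]. Finally every [Phi] has such a decomposition with [M] close
    to 1: let [u i] be the mean step of a path of a random walk with
    independent +1, -1 coordinates of means given by [Phi x], and [W i x] the
    probability of the path. The mean of the walk is exact, and its small
    variance makes [M] tend to 1 as the number of steps grows. *)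

Set Implicit Arguments.
Unset Strict Implicit.
Unset Printing Implicit Defensive.

Import Order.TTheory GRing.Theory Num.Theory.

Local Open Scope classical_set_scope.
Local Open Scope ring_scope.

(** * Smooth functions and a smooth transition *)

Section CkTheory.
Variables (R : realType) (V : normedModType R) (E : seq V).
Implicit Types (f g : V -> R) (k : nat).

Lemma Ck_continuous k f : Ck E k f -> continuous f.
Proof. by case: k => [|k] []. Qed.

Lemma CkS k f : Ck E k.+1 f -> Ck E k f.
Proof.
elim: k f => [|k IH] f [cf /= df]; split => // e /df[dfe Ce].
by split => //; exact: IH.
Qed.

Lemma Ck_cst k c : Ck E k (fun _ : V => c).
Proof.
elim: k c => [|k IH] c; split => //; try exact: cst_continuous.
move=> e _; split => [x|]; first exact: derivable_cst.
rewrite (_ : 'D_e _ = fun=> 0) //.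
by apply/funext => x; rewrite derive_cst.
Qed.

Lemma CkD k f g : Ck E k f -> Ck E k g -> Ck E k (fun x => f x + g x).
Proof.
elim: k f g => [|k IH] f g [cf /= df] [cg /= dg]; split => //;
  try by move=> x; apply: continuousD; [exact: cf | exact: cg].
move=> e eE; have [dfe Cf] := df _ eE; have [dge Cg] := dg _ eE.
split => [x|]; first exact: derivableD.
rewrite (_ : 'D_e _ = fun x => 'D_e f x + 'D_e g x); first exact: IH.
by apply/funext => x; rewrite deriveD.
Qed.

Lemma CkM k f g : Ck E k f -> Ck E k g -> Ck E k (fun x => f x * g x).
Proof.
elim: k f g => [|k IH] f g Cf Cg;
  have cf := Ck_continuous Cf; have cg := Ck_continuous Cg; split => //;
  try by move=> x; apply: continuousM; [exact: cf | exact: cg].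
move=> e eE; have [dfe Cf'] := Cf.2 _ eE; have [dge Cg'] := Cg.2 _ eE.
split => [x|]; first exact: derivableM.
rewrite (_ : 'D_e _ = fun x => f x * 'D_e g x + g x * 'D_e f x).
  by apply: CkD; apply: IH => //; exact: CkS.
by apply/funext => x; rewrite deriveM.
Qed.

Lemma CkZ k c f : Ck E k f -> Ck E k (fun x => c * f x).
Proof. by move=> Cf; apply: CkM => //; exact: Ck_cst. Qed.

Lemma CkX k n f : Ck E k f -> Ck E k (fun x => f x ^+ n).
Proof.
move=> Cf; elim: n => [|n IH]; first exact: Ck_cst.
by under eq_fun do rewrite exprS; exact: CkM.
Qed.

Lemma Ck_sum k I (s : seq I) (P : pred I) (F : I -> V -> R) :
  (forall i, Ck E k (F i)) -> Ck E k (fun x => \sum_(i <- s | P i) F i x).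
Proof.
move=> CF; elim: s => [|i s IH].
  by under eq_fun do rewrite big_nil; exact: Ck_cst.
under eq_fun do rewrite big_cons.
by case: (P i) => //; exact: CkD.
Qed.

Lemma CkV k f : (forall x, f x != 0) -> Ck E k f -> Ck E k (fun x => (f x)^-1).
Proof.
move=> f0; elim: k => [|k IH] Cf; have cf := Ck_continuous Cf; split => //;
  try by move=> x; apply: continuousV => //; exact: cf.
move=> e eE; have [dfe Cf'] := Cf.2 _ eE.
split => [x|]; first exact: derivableV.
rewrite (_ : 'D_e _ = fun x => - 1 * ((f x)^-1 ^+ 2 * 'D_e f x)).
  by apply: CkZ; apply: CkM => //; apply: CkX; apply: IH; exact: CkS.
apply/funext => x; rewrite deriveV //.
by rewrite /GRing.scale /= mulN1r exprVn mulNr.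
Qed.

End CkTheory.

Lemma Ck1_derive1 (R : realType) (g : R -> R) : Ck [:: 1 : R] 1 g ->
  (forall x, derivable g x 1) /\ continuous ('D_1 g).
Proof. by move=> Cg; have [dg [cg _]] := Cg.2 1 (mem_head _ _). Qed.

Section AffineSubstitution.
Variables (R : realType) (V : normedModType R) (L : V -> R) (c : V -> R).
Hypotheses (cL : continuous L) (affL : forall h x e, L (h *: e + x) = h * c e + L x).

Lemma is_derive_comp_affine (g : R -> R) x e : derivable g (L x) 1 ->
  is_derive x e (g \o L) (c e * 'D_1 g (L x)).
Proof.
move=> /derivable1_diffP dg.
have E : (fun h : R => h^-1 *: ((g \o L) (h *: e + x) - (g \o L) x)) =
    (fun h => h^-1 *: (g (h *: (c e : R) + L x) - g (L x))).
  by apply/funext => h; rewrite /= affL.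
apply: DeriveDef.
  by rewrite /derivable E; exact: (diff_derivable (v := (c e : R))).
rewrite /derive E -/(derive g (L x) (c e)) deriveE //.
by rewrite deriv1E ?derive1E //; exact/derivable1_diffP.
Qed.

(** Stated for an arbitrary normed domain so that it serves both for rescalings
    of the line and for functions of one linear coordinate of the plane. *)
Lemma Ck_comp_affine (E : seq V) (g : R -> R) k :
  Ck [:: 1 : R] k g -> Ck E k (g \o L).
Proof.
elim: k g => [|k IH] g Cg; have cg := Ck_continuous Cg; split => //;
  try by move=> x; apply: continuous_comp; [exact: cL | exact: cg].
move=> e eE; have [dg Cg'] := Cg.2 1 (mem_head _ _).
have D x := is_derive_comp_affine e (dg (L x)).
split => [x|]; first by case: (D x).
rewrite (_ : 'D_e _ = fun x => c e * ('D_1 g \o L) x); first exact/CkZ/IH.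
by apply/funext => x; case: (D x).
Qed.

End AffineSubstitution.

Section SmoothStep.
Variable R : realType.
Implicit Types (x : R) (n k : nat).

(** The function [exp (- 1 / x) / x ^ n], extended by 0. The powers in the
    denominator make the family closed under differentiation up to linear
    combinations, so that one induction proves that all its members are smooth. *)
Definition flat n x : R := if 0 < x then x^-1 ^+ n * expR (- x^-1) else 0.

Lemma flat_ge0 n x : 0 <= flat n x.
Proof.
rewrite /flat; case: ifPn => // x0.
by rewrite mulr_ge0 ?expR_ge0 // exprn_ge0 // invr_ge0 ltW.
Qed.

Lemma flat_gt0 n x : 0 < x -> 0 < flat n x.
Proof. by move=> x0; rewrite /flat x0 mulr_gt0 ?expR_gt0 // exprn_gt0 // invr_gt0. Qed.

Lemma flat_le0 n x : x <= 0 -> flat n x = 0.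
Proof. by move=> x0; rewrite /flat ltNge x0. Qed.

(** This quadratic bound, from [y ^ (n + 2) / (n + 2)! <= exp y], makes the
    function derivable at 0. *)
Lemma flat_le n x : flat n x <= n.+2`!%:R * x ^+ 2.
Proof.
rewrite /flat; case: ifPn => [x0|_]; last by rewrite mulr_ge0 ?sqr_ge0.
have y0 : 0 < x^-1 by rewrite invr_gt0.
have := @expR_ge1Dxn R x^-1 n.+1 (ltW y0).
move=> /(le_trans _) -/(_ (x^-1 ^+ n.+2 / n.+2`!%:R)); rewrite lerDr ler01 => /(_ isT) H.
have f0 : 0 < (n.+2`!%:R : R) by rewrite ltr0n fact_gt0.
rewrite expRN ler_pdivrMr ?expR_gt0 // (le_trans _ (ler_wpM2l _ H)) //; last first.
  by rewrite mulr_ge0 ?sqr_ge0 // ltW.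
move: f0; move: (_`!%:R : R) => F F0; rewrite (exprS _ n.+1) (exprS _ n).
move: (x^-1 ^+ n) => z; rewrite le_eqVlt; apply/orP; left; apply/eqP; field.
by rewrite !gt_eqF.
Qed.

Lemma is_derive_flat n x :
  is_derive x 1 (flat n) (flat n.+2 x - n%:R * flat n.+1 x).
Proof.
have [x0|x0|->] := ltgtP x 0.
- rewrite !flat_le0 ?(ltW x0) // mulr0 subr0.
  apply: near_eq_is_derive (is_derive_cst (0 : R) x 1).
  near=> y; rewrite flat_le0 // ltW //; near: y; exact: lt_nbhsl.
- pose f (y : R) := (y^-1) ^+ n * expR (- y^-1).
  apply: (@near_eq_is_derive _ _ _ f).
    by near=> y; rewrite /flat ifT //; near: y; exact: lt_nbhsr.
  have dV : is_derive x 1 (fun y : R => y^-1) (- x ^- 2).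
    apply: is_derive_eq; first by apply: is_deriveV; rewrite gt_eqF.
    by rewrite /GRing.scale /= mulr1.
  have dX : is_derive x 1 (fun y : R => (y^-1) ^+ n)
      ((n%:R * x^-1 ^+ n.-1) *: (- x ^- 2)).
    rewrite (_ : (fun y : R => _) = (fun y : R => y^-1) ^+ n).
      exact: is_deriveX.
    by apply/funext => y; rewrite exprfctE.
  have dE : is_derive x 1 (fun y : R => expR (- y^-1)) (expR (- x^-1) * (x ^- 2)).
    apply: (@is_derive1_comp _ expR (fun y : R => - y^-1)).
    by rewrite -[x ^- 2]opprK; exact: is_deriveN.
  have dM := is_deriveM dX dE.
  rewrite (_ : f = (fun y : R => (y^-1) ^+ n) * (fun y : R => expR (- y^-1))) //.
  apply: (is_derive_eq dM).
  rewrite /flat x0 /GRing.scale /=.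
  case: (n) => [|m]; rewrite /= ?exprS ?expr0; field; rewrite ?gt_eqF //.
- rewrite !flat_le0 // mulr0 subr0.
  have cv : h^-1 *: (flat n (h *: 1 + 0) - flat n 0) @[h --> 0^'] --> (0 : R).
    have F0 : 0 < (n.+2`!%:R : R) by rewrite ltr0n fact_gt0.
    apply/cvgr0Pnorm_lt => e e0.
    near=> h; rewrite (@flat_le0 n 0) // subr0 addr0 /GRing.scale /= mulr1.
    have h0 : h != 0 by near: h; exact: nbhs_dnbhs_neq.
    rewrite normrM normfV ger0_norm ?flat_ge0 //.
    apply: le_lt_trans (_ : n.+2`!%:R * `|h| < e).
      rewrite ler_pdivrMl ?normr_gt0 // (le_trans (flat_le _ _)) //.
      by rewrite [leRHS]mulrCA -expr2 real_normK ?num_real.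
    rewrite mulrC -ltr_pdivlMr //; near: h.
    by apply: dnbhs0_lt; rewrite divr_gt0.
  by apply: DeriveDef; [apply/cvg_ex; exists 0 | exact: cvg_lim cv].
Unshelve. all: by end_near. Qed.

Lemma Ck_flat k n : Ck [:: 1 : R] k (flat n).
Proof.
have cf m : continuous (flat m).
  move=> x; apply/differentiable_continuous/derivable1_diffP.
  by case: (is_derive_flat m x).
elim: k n => [|k IH] n; split => // e; rewrite inE => /eqP ->.
split => [x|]; first by case: (is_derive_flat n x).
rewrite (_ : 'D_(1 : R) (flat n) = fun x => flat n.+2 x + (- n%:R) * flat n.+1 x).
  by apply: CkD => //; exact: CkZ.
apply/funext => x; rewrite mulNr; by case: (is_derive_flat n x).
Qed.

(** A smooth nondecreasing transition from 0 on the negative axis to 1 beyond 1. *)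
Definition step x : R := flat 0 x / (flat 0 x + flat 0 (1 - x)).

Let den_gt0 x : 0 < flat 0 x + flat 0 (1 - x).
Proof.
have [x0|x0] := ltP 0 x.
  by rewrite ltr_pwDl ?flat_gt0 ?flat_ge0.
by rewrite ltr_wpDl ?flat_ge0 // flat_gt0 // subr_gt0 (le_lt_trans x0).
Qed.

Lemma step_ge0 x : 0 <= step x.
Proof. by rewrite divr_ge0 ?flat_ge0 // ltW. Qed.

Lemma step_le1 x : step x <= 1.
Proof. by rewrite ler_pdivrMr // mul1r lerDl flat_ge0. Qed.

Lemma step_0 x : x <= 0 -> step x = 0.
Proof. by move=> x0; rewrite /step flat_le0 // mul0r. Qed.

Lemma step_1 x : 1 <= x -> step x = 1.
Proof.
move=> x1; rewrite /step (@flat_le0 0 (1 - x)) ?subr_le0 // addr0 divff //.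
by rewrite gt_eqF // flat_gt0 // (lt_le_trans ltr01).
Qed.

Let affine_continuous (a b : R) : continuous (fun y : R => a * y + b).
Proof.
move=> y; apply: (@continuousD _ _ _ (fun y : R => a * y) (fun=> b)).
  by apply: (@continuousM _ _ (fun=> a) id); [exact: cst_continuous | exact: cvg_id].
exact: cst_continuous.
Qed.

Let affineE (a b h x e : R) : a * (h *: e + x) + b = h * (a * e) + (a * x + b).
Proof. by change (a * (h * e + x) + b = h * (a * e) + (a * x + b)); ring. Qed.

Lemma Ck_affine k (g : R -> R) a b :
  Ck [:: 1 : R] k g -> Ck [:: 1 : R] k (fun x => g (a * x + b)).
Proof.
exact: (Ck_comp_affine (@affine_continuous a b) (c := *%R a) (@affineE a b)).
Qed.

Lemma is_derive_affine (g : R -> R) a b x : derivable g (a * x + b) 1 ->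
  is_derive x 1 (fun x => g (a * x + b)) (a * 'D_1 g (a * x + b)).
Proof.
move=> dg; have := is_derive_comp_affine (c := *%R a) (@affineE a b) 1 dg.
by rewrite mulr1.
Qed.

Lemma Ck_step k : Ck [:: 1 : R] k step.
Proof.
apply: CkM; first exact: Ck_flat.
apply: CkV => [x|]; first by rewrite gt_eqF.
apply: CkD; first exact: Ck_flat.
under eq_fun do rewrite addrC -mulN1r.
by apply: Ck_affine; exact: Ck_flat.
Qed.

Lemma derive_step_ge0 x : 0 <= 'D_1 step x.
Proof.
have da := is_derive_flat 0 x.
have db : is_derive x 1 (fun y => flat 0 (1 - y)) (- flat 2 (1 - x)).
  have d1 : is_derive x 1 (fun y : R => 1 - y) (0 - 1) by exact: is_deriveB.
  have dc := @is_derive1_comp _ (flat 0) (fun y => 1 - y) x _ _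
    (is_derive_flat 0 (1 - x)) d1.
  apply: (is_derive_eq dc).
  by rewrite mul0r !(subr0, sub0r) mulrN1.
have dd : is_derive x 1 (fun y => flat 0 y + flat 0 (1 - y))
  (flat 2 x - 0 * flat 1 x - flat 2 (1 - x)) by exact: is_deriveD.
have di : is_derive x 1 (fun y => (flat 0 y + flat 0 (1 - y))^-1)
    (- (flat 0 x + flat 0 (1 - x)) ^- 2 *: (flat 2 x - 0 * flat 1 x - flat 2 (1 - x))).
  by apply: is_deriveV; rewrite gt_eqF.
have /@derive_val -> := is_deriveM da di.
have := den_gt0 x; rewrite /GRing.scale /= mul0r subr0.
move: (flat_ge0 0 x) (flat_ge0 2 x) (flat_ge0 0 (1 - x)) (flat_ge0 2 (1 - x)).
move: (flat 0 x) (flat 2 x) (flat 0 (1 - x)) (flat 2 (1 - x)) => a a' b b'.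
move=> a0 a'0 b0 b'0 ab0.
rewrite [leRHS](_ : _ = (a' * b + a * b') / (a + b) ^+ 2); last first.
  by field; rewrite gt_eqF.
by rewrite divr_ge0 ?sqr_ge0 // addr_ge0 // mulr_ge0.
Qed.

Section Ramp.
Variables a b : R.
Hypothesis ab : a < b.

(** The transition rescaled to climb from 0 at [a] to 1 at [b]. *)
Definition ramp x := step ((b - a)^-1 * x + - ((b - a)^-1 * a)).

Let ba0 : 0 < b - a. Proof. by rewrite subr_gt0. Qed.

Let arg x : (b - a)^-1 * x + - ((b - a)^-1 * a) = (x - a) / (b - a).
Proof. by rewrite -mulrBr mulrC. Qed.

Lemma Ck_ramp k : Ck [:: 1 : R] k ramp.
Proof. by apply: Ck_affine; exact: Ck_step. Qed.

Lemma ramp01 x : 0 <= ramp x <= 1.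
Proof. by rewrite step_ge0 step_le1. Qed.

Lemma ramp_0 x : x <= a -> ramp x = 0.
Proof. by move=> xa; rewrite /ramp arg step_0 // ler_pdivrMr // mul0r subr_le0. Qed.

Lemma ramp_1 x : b <= x -> ramp x = 1.
Proof. by move=> bx; rewrite /ramp arg step_1 // ler_pdivlMr // mul1r lerD2r. Qed.

Lemma derive_ramp_ge0 x : 0 <= 'D_1 ramp x.
Proof.
have dstep y : derivable step y 1 by exact: (Ck1_derive1 (Ck_step 1)).1.
have [_ D] := @is_derive_affine step (b - a)^-1 (- ((b - a)^-1 * a)) x (dstep _).
rewrite /ramp D.
by rewrite mulr_ge0 ?derive_step_ge0 // invr_ge0 ltW.
Qed.

Lemma derive_ramp_out x : ~~ (a <= x <= b) -> 'D_1 ramp x = 0.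
Proof.
rewrite negb_and -!ltNge => /orP[x0|x0].
- rewrite -(derive_cst (0 : R) x 1); apply: near_eq_derive.
  by near=> y; rewrite ramp_0 // ltW //; near: y; exact: lt_nbhsl.
- rewrite -(derive_cst (1 : R) x 1); apply: near_eq_derive.
  by near=> y; rewrite ramp_1 // ltW //; near: y; exact: lt_nbhsr.
Unshelve. all: by end_near. Qed.

End Ramp.

Lemma plateau (B : R) :
  exists eta : R -> R, [/\ forall k, Ck [:: 1 : R] k eta,
    forall x, 0 <= eta x <= 1, forall x, `|x| <= B -> eta x = 1 &
    forall x, B + 1 < `|x| -> eta x = 0].
Proof.
have lo : - (B + 1) < - B by rewrite ltrN2 ltrDl.
have hi : B < B + 1 by rewrite ltrDl.
exists (fun x => ramp (- (B + 1)) (- B) x * (1 + -1 * ramp B (B + 1) x)); split => [k|x|x|x].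
- exact: (CkM (Ck_ramp _ _ k) (CkD (Ck_cst _ k 1) (CkZ (-1) (Ck_ramp _ _ k)))).
- have /andP[a0 a1] := ramp01 (- (B + 1)) (- B) x; have /andP[b0 b1] := ramp01 B (B + 1) x.
  rewrite mulN1r mulr_ge0 ?subr_ge0 //=.
  by rewrite mulr_ile1 ?subr_ge0 // lerBlDr lerDl.
- by rewrite ler_norml => /andP[x1 x2]; rewrite ramp_1 // ramp_0 // mulr0 addr0 mulr1.
- have [x0|x0] := leP 0 x; [rewrite ger0_norm // | rewrite ltr0_norm //] => xB.
    by rewrite [X in 1 + -1 * X]ramp_1 ?mulr1 ?subrr ?mulr0 // ltW.
  by rewrite ramp_0 ?mul0r // lerNr ltW.
Qed.

End SmoothStep.

(** * Area in the plane and its invariance under rotations *)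

HB.instance Definition _ (R : realType) := Measure.on (@lebesgue2 R).

Section PlaneMeasurability.
Variable R : realType.
Local Notation line := (measurableTypeR R).
Local Notation plane := (line * line)%type.

(** An open set of the plane is the union of the countably many squares with
    rational centre and inverse integer radius that it contains. *)
Lemma open_measurable2 (O : set (R * R)) : open O -> measurable (O : set plane).
Proof.
move=> oO.
pose r n : R := n.+1%:R^-1.
pose box (p : rat * rat * nat) : set (R * R) :=
  ball (ratr p.1.1 : R) (r p.2) `*` ball (ratr p.1.2 : R) (r p.2).
rewrite (_ : O = \bigcup_p (if `[< box p `<=` O >] then box p else set0)).
  apply: countable_bigcupT_measurable => [|p].
    exact: countableP.
  case: ifPn => // _; by apply: measurableX; apply: open_measurable; exact: ball_open.
apply/seteqP; split => [x Ox|x [p _]]; last by case: ifPn => // /asboolP; apply.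
have /nbhs_ballP [e /= e0 xe] : nbhs x O by move: oO; rewrite openE => /(_ x Ox).
have [n ne] : exists n, r n < e / 2.
  have := near_infty_natSinv_lt (PosNum (divr_gt0 e0 (@ltr0Sn R 1))).
  by case=> n _ Hn; exists n; exact: (Hn n (leqnn n)).
have rn0 : 0 < r n by rewrite invr_gt0 ltr0n.
have aux (y : R) : exists q : rat, ball (ratr q : R) (r n) y.
  have [||z [zy [q _ qz]]] := @dense_rat R (ball y (r n)).
  - by exists y; exact: ballxx.
  - exact: ball_open.
  - by exists q; rewrite qz; exact: ball_sym.
have [q1 h1] := aux x.1; have [q2 h2] := aux x.2.
exists (q1, q2, n) => //; rewrite ifT //; apply/asboolP => y [/= y1 y2].
apply: xe; split; rewrite /= (splitr e).
  by apply: (@ball_triangle _ _ (ratr q1 : R)); apply: le_ball (ltW ne) _ _;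
    [exact: ball_sym|].
by apply: (@ball_triangle _ _ (ratr q2 : R)); apply: le_ball (ltW ne) _ _;
  [exact: ball_sym|].
Qed.

Lemma closed_measurable2 (K : set (R * R)) : closed K -> measurable (K : set plane).
Proof. by move/closed_openC/open_measurable2/measurableC; rewrite setCK. Qed.

Lemma continuous_measurable2 (f : R * R -> R) :
  continuous f -> measurable_fun setT (f : plane -> line).
Proof.
move=> cf; apply: (measurability _ (RGenOpens.measurableE R)) => _ [_ [a [b ->]] <-].
rewrite setTI; apply: open_measurable2.
by move/continuousP : cf; apply; exact: interval_open.
Qed.

Lemma lebesgue_measureD (c : R) (A : set line) : measurable A ->
  lebesgue_measure ((fun x => x + c) @^-1` A) = lebesgue_measure A.
Proof.
move=> mA.
have mf : measurable_fun setT (fun x : measurableTypeR R => (x + c : measurableTypeR R)).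
  exact: measurable_funD.
suff : pushforward (@lebesgue_measure R) (fun x => x + c : measurableTypeR R) A
    = lebesgue_measure A by [].
apply/esym/lebesgue_measure_unique => //= _ [[a b]] _ <-.
rewrite /pushforward /= (_ : _ @^-1` _ = `]a - c, b - c]%classic); last first.
  by apply/seteqP; split => x /=; rewrite !in_itv /= ltrBlDr lerBrDr.
rewrite !lebesgue_measure_itv /= !lte_fin ltrD2r -!EFinD.
by case: ifPn => // _; congr _%:E; ring.
Qed.

Lemma lebesgue2_unique (m : {measure set (plane) -> \bar R}) :
  (forall A B, measurable A -> measurable B ->
    m (A `*` B) = (@lebesgue_measure R A * @lebesgue_measure R B)%E) ->
  forall X, measurable X -> m X = @lebesgue2 R X.
Proof.
move=> mE X mX; apply/esym; rewrite /lebesgue2.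
exact: product_measure_unique.
Qed.

Definition area_preserving (T : plane -> plane) :=
  measurable_fun setT T /\
  forall A, measurable A -> @lebesgue2 R (T @^-1` A) = @lebesgue2 R A.

Lemma area_preserving_comp S T :
  area_preserving S -> area_preserving T -> area_preserving (S \o T).
Proof.
move=> [mS ES] [mT ET]; split; first exact: measurableT_comp.
move=> A mA; rewrite comp_preimage ET ?ES //.
by rewrite -[X in measurable X]setTI; exact: mS.
Qed.

Definition shear2 (a : R) (p : plane) : plane := (p.1, p.2 + a * p.1).
Definition swap (p : plane) : plane := (p.2, p.1).

(** On each vertical line a vertical shear is a translation. *)
Lemma area_preserving_shear2 a : area_preserving (shear2 a).
Proof.
have mT : measurable_fun setT (shear2 a).
  apply: measurable_fun_pair => //; apply: measurable_funD => //.
  exact: measurable_funM.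
split => // X mX.
suff : pushforward (@lebesgue2 R) (shear2 a) X
    = @lebesgue2 R X by [].
apply: lebesgue2_unique => //= A B mA mB.
rewrite /pushforward -product_measure1E // /lebesgue2 /product_measure1 /=.
apply: eq_integral => x _.
have [xA|xA] := boolP (x \in A).
  rewrite in_xsectionX // -(lebesgue_measureD (a * x : R) mB); congr lebesgue_measure.
  apply/seteqP; split => y /=; rewrite /xsection /= inE /=; first by case.
  by move=> By; split => //; exact/set_mem.
rewrite notin_xsectionX // measure0 (_ : xsection _ _ = set0) ?measure0 //.
apply/seteqP; split => y //=; rewrite /xsection /= inE /= => -[xA' _].
by move/negP: xA; apply; exact/mem_set.
Qed.

Lemma area_preserving_swap : area_preserving swap.
Proof.
have mT : measurable_fun setT swap.
  exact: measurable_fun_pair.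
split => // X mX.
suff : pushforward (@lebesgue2 R) swap X
    = @lebesgue2 R X by [].
apply: lebesgue2_unique => //= A B mA mB.
rewrite /pushforward muleC -product_measure1E // /lebesgue2 /product_measure1 /=.
apply: eq_integral => x _; congr lebesgue_measure.
by apply/seteqP; split => y /=; rewrite /xsection /= !inE /= => -[].
Qed.

Lemma area_preserving_shear1 a :
  area_preserving (fun p => (p.1 + a * p.2, p.2)).
Proof.
have := area_preserving_comp area_preserving_swap
  (area_preserving_comp (area_preserving_shear2 a) area_preserving_swap).
by congr area_preserving.
Qed.

(** Coordinates adapted to the lines orthogonal to a direction: the line with
    offset [p.1], parametrized by [p.2]. *)
Definition rot (theta p : R * R) : R * R :=
  p.1 *: theta + p.2 *: (- theta.2, theta.1).

Lemma rotE theta p :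
  rot theta p = (theta.1 * p.1 - theta.2 * p.2, theta.2 * p.1 + theta.1 * p.2).
Proof.
case: theta p => c s [x y]; congr pair.
  change (x * c + y * - s = c * x - s * y); ring.
by change (x * s + y * c = s * x + c * y); ring.
Qed.

Lemma circleP (theta : R * R) :
  circle theta <-> theta.1 ^+ 2 + theta.2 ^+ 2 = 1.
Proof.
rewrite /circle /enorm /=; split => [h|->]; last by rewrite sqrtr1.
by rewrite -[LHS]sqr_sqrtr ?addr_ge0 ?sqr_ge0 // h expr1n.
Qed.

(** A rotation is a product of three shears, except the half-turn, which is the
    square of a quarter-turn. *)
Lemma area_preserving_rot theta : circle theta -> area_preserving (rot theta).
Proof.
have main t : circle t -> t.1 != -1 -> area_preserving (rot t).
  case: t => c s /circleP /= cs1 c1.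
  have c0 : 1 + c != 0 by rewrite addrC -[1]opprK subr_eq0.
  (* [a] is minus the tangent of half the rotation angle. *)
  pose a := - s / (1 + c).
  have := area_preserving_comp (area_preserving_shear1 a)
    (area_preserving_comp (area_preserving_shear2 s) (area_preserving_shear1 a)).
  congr area_preserving; apply/funext => -[x y]; rewrite rotE /=.
  have s2 : s ^+ 2 = (1 - c) * (1 + c) by rewrite -[LHS](addKr (c ^+ 2)) cs1; ring.
  have as_ : s * a = c - 1 by rewrite /a mulrA mulrN -expr2 s2; field.
  have ac : a * (1 + c) = - s by rewrite /a divfK.
  have e2 : y + s * (x + a * y) = s * x + c * y.
    by rewrite mulrDr mulrA as_; ring.
  rewrite e2; congr pair.
  transitivity (x + s * a * x + a * (1 + c) * y); first by ring.
  by rewrite as_ ac; ring.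
move=> ct; have [t1|] := eqVneq theta.1 (-1); last exact: main.
have t2 : theta.2 = 0.
  move/circleP: ct; rewrite t1 sqrrN expr1n => /eqP.
  by rewrite eq_sym -subr_eq0 opprD addrA subrr sub0r oppr_eq0 sqrf_eq0 => /eqP.
have q : area_preserving (rot (0, 1)).
  apply: main; first by apply/circleP; rewrite /= expr0n add0r expr1n.
  by rewrite /= eq_sym oppr_eq0 oner_eq0.
have := area_preserving_comp q q; congr area_preserving; apply/funext => -[x y].
by rewrite /= !rotE /= t1 t2; congr pair; ring.
Qed.

End PlaneMeasurability.

(** * Directional derivatives of functions of class C1 *)

Section DirectionalDerivative.
Variable R : realType.

Lemma mean_value (f df : R -> R) (a k : R) :
  (forall x : R, is_derive x 1 f (df x)) ->
  exists2 c, `|c| <= `|k| & f (a + k) - f a = k * df (a + c).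
Proof.
move=> Df.
have cf : continuous f.
  by move=> x; apply/differentiable_continuous/derivable1_diffP; case: (Df x).
have mvt x y : x <= y -> exists2 c, c \in `[x, y] & f y - f x = df c * (y - x).
  move=> xy; apply: (MVT_segment xy).
  exact: continuous_subspaceT.
have [k0|k0] := leP 0 k.
  have /mvt[c] : a <= a + k by rewrite lerDl.
  rewrite in_itv /= => /andP[ac ck] E; exists (c - a).
    by rewrite !ger0_norm ?subr_ge0 // lerBlDl.
  by rewrite E (addrC a) addrK mulrC addrCA subrr addr0.
have /mvt[c] : a + k <= a by rewrite gerDl ltW.
rewrite in_itv /= => /andP[ac ck] E; exists (c - a).
  by rewrite (ltr0_norm k0) ler0_norm ?subr_le0 // lerN2 lerBrDl.
by rewrite -opprB E [a + (c - a)]addrC subrK opprD addrA subrr sub0r mulrN opprK mulrC.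
Qed.

Lemma is_derive_partial1 (f : R * R -> R) (y : R) : (forall p, derivable f p (e1 R)) ->
  forall x : R, is_derive x 1 (fun t => f (t, y)) ('D_(e1 R) f (x, y)).
Proof.
move=> df x.
have E : (fun h : R => h^-1 *: (f (h *: 1 + x, y) - f (x, y))) =
    (fun h => h^-1 *: (f (h *: e1 R + (x, y)) - f (x, y))).
  apply/funext => h; congr (_ *: (f _ - _)).
  by congr pair; rewrite /= scaler0 add0r.
apply: DeriveDef; first by rewrite /derivable E; exact: df.
by rewrite /derive E.
Qed.

Lemma is_derive_partial2 (f : R * R -> R) (x : R) : (forall p, derivable f p (e2 R)) ->
  forall y : R, is_derive y 1 (fun t => f (x, t)) ('D_(e2 R) f (x, y)).
Proof.
move=> df y.
have E : (fun h : R => h^-1 *: (f (x, h *: 1 + y) - f (x, y))) =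
    (fun h => h^-1 *: (f (h *: e2 R + (x, y)) - f (x, y))).
  apply/funext => h; congr (_ *: (f _ - _)).
  by congr pair; rewrite /= scaler0 add0r.
apply: DeriveDef; first by rewrite /derivable E; exact: df.
by rewrite /derive E.
Qed.

(** The increment along [h v] splits into a horizontal and a vertical one; the
    mean value theorem turns both into values of the partial derivatives near
    the base point, where these are continuous. *)
Lemma is_derive_C1 (f : R * R -> R) (v q : R * R) : Ck [:: e1 R; e2 R] 1 f ->
  is_derive q v f (v.1 * 'D_(e1 R) f q + v.2 * 'D_(e2 R) f q).
Proof.
move=> [_ Cf].
have [d1 [c1 _]] := Cf (e1 R) (mem_head _ _).
have [d2 [c2 _]] : (forall x, derivable f x (e2 R)) /\ Ck [:: e1 R; e2 R] 0 ('D_(e2 R) f).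
  by apply: Cf; rewrite !inE eqxx orbT.
set L := _ + _.
suff cv : h^-1 *: (f (h *: v + q) - f q) @[h --> 0^'] --> L.
  by apply: DeriveDef; [apply/cvg_ex; exists L | exact: cvg_lim cv].
have N0 : 0 < `|v.1| + `|v.2| + 1 by rewrite ltr_wpDl // addr_ge0.
apply/cvgrPdist_lt => e e0.
pose e' := e / (`|v.1| + `|v.2| + 1).
have e'0 : 0 < e' by rewrite divr_gt0.
have /cvgrPdist_lt /(_ _ e'0) /nbhs_ballP [r1 /= r10 B1] := c1 q.
have /cvgrPdist_lt /(_ _ e'0) /nbhs_ballP [r2 /= r20 B2] := c2 q.
near=> h.
have h0 : h != 0 by near: h; exact: nbhs_dnbhs_neq.
have hN r : 0 < r -> `|h| < r / (`|v.1| + `|v.2| + 1) ->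
  (`|h * v.1| < r) /\ (`|h * v.2| < r).
  move=> r0; rewrite ltr_pdivlMr // => hr; split; apply: le_lt_trans hr;
  by rewrite normrM ler_wpM2l // -?addrA ?lerDl 1?addrCA ?lerDl ?addr_ge0.
have [hr11 hr12] : (`|h * v.1| < r1) /\ (`|h * v.2| < r1).
  by apply: hN => //; near: h; apply: dnbhs0_lt; rewrite divr_gt0.
have [hr21 hr22] : (`|h * v.1| < r2) /\ (`|h * v.2| < r2).
  by apply: hN => //; near: h; apply: dnbhs0_lt; rewrite divr_gt0.
have [x1 x1h E1] := mean_value q.1 (h * v.1)
  (is_derive_partial1 (q.2 + h * v.2) d1).
have [x2 x2h E2] := mean_value q.2 (h * v.2) (is_derive_partial2 q.1 d2).
rewrite (_ : f (h *: v + q) - f q =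
   h * (v.1 * 'D_(e1 R) f (q.1 + x1, q.2 + h * v.2)
      + v.2 * 'D_(e2 R) f (q.1, q.2 + x2))); last first.
  rewrite mulrDr 2!mulrA -E1 -E2 addrA subrK.
  congr (f _ - f _); last by case: (q).
  by rewrite (addrC q.1) (addrC q.2).
rewrite /GRing.scale /= mulKf //.
rewrite /L opprD addrACA -!mulrBr.
have P1 : ball q r1 (q.1 + x1, q.2 + h * v.2).
  by split => /=; rewrite /ball /= opprD addNKr normrN // (le_lt_trans x1h).
have P2 : ball q r2 (q.1, q.2 + x2).
  split => /=; rewrite /ball /=; first by rewrite subrr normr0.
  by rewrite opprD addNKr normrN // (le_lt_trans x2h).
apply: (le_lt_trans (ler_normD _ _)); rewrite !normrM.
apply: (@le_lt_trans _ _ ((`|v.1| + `|v.2|) * e')).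
  rewrite mulrDl; apply: lerD; apply: ler_wpM2l => //; apply: ltW.
    exact: B1.
  exact: B2.
by rewrite /e' mulrA ltr_pdivrMr // mulrC ltr_pM2l // ltrDl.
Unshelve. all: by end_near. Qed.

End DirectionalDerivative.

(** * Integrals over bounded closed sets of the plane *)

Section BoundedPlaneSets.
Variable R : realType.
Local Notation line := (measurableTypeR R).
Local Notation plane := (line * line)%type.
Local Notation lambda := (@lebesgue_measure R).

Lemma bounded_box (K : set (R * R)) : bounded_set K ->
  exists2 M, 0 < M & forall x, K x -> `|x.1| <= M /\ `|x.2| <= M.
Proof.
move=> /ex_strict_bound_gt0[M M0 KM]; exists M => // x /KM /= /ltW.
by rewrite ge_max => /andP[].
Qed.

Lemma bounded_closed_compact2 (K : set (R * R)) :
  bounded_set K -> closed K -> compact K.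
Proof.
move=> /bounded_box[M M0 KM] cK.
apply: (subclosed_compact cK
  (compact_setX (@segment_compact R (- M) M) (@segment_compact R (- M) M))).
by move=> x /KM[x1 x2]; split; rewrite /= in_itv /= -ler_norml.
Qed.

Lemma lebesgue2_bounded_lty (K : set (R * R)) :
  bounded_set K -> measurable (K : set plane) -> (@lebesgue2 R K < +oo)%E.
Proof.
move=> /bounded_box[M M0 KM] mK.
pose I : set R := `[- M, M]%classic.
have mI : measurable (I : set line) by exact: measurable_itv.
have lI : lambda I = (M + M)%:E.
  by rewrite lebesgue_measure_itv /= lte_fin gtrN // -EFinB opprK.
apply: (@le_lt_trans _ _ (@lebesgue2 R (I `*` I))).
  apply: le_measure; rewrite ?inE //; first exact: measurableX.
  by move=> x /KM[x1 x2]; split; rewrite /I /= in_itv /= -ler_norml.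
have -> : @lebesgue2 R (I `*` I) = (lambda I * lambda I)%E by exact: product_measure1E.
by rewrite lI -EFinM ltry.
Qed.

Lemma continuous_bounded (K : set (R * R)) (h : R * R -> R) : compact K -> continuous h ->
  exists C, forall x, K x -> `|h x| <= C.
Proof.
move=> cK ch.
have /compact_bounded/ex_strict_bound_gt0[C _ hC] : compact (h @` K).
  by apply: continuous_compact => //; exact: continuous_subspaceT.
by exists C => x Kx; apply/ltW/hC; exists x.
Qed.

Lemma integrable_indicM (A : set plane) (h : plane -> R) (C : R) :
  measurable A -> (@lebesgue2 R A < +oo)%E -> measurable_fun setT (h : plane -> line) ->
  (forall x, A x -> `|h x| <= C) ->
  (@lebesgue2 R).-integrable setT (fun x => (\1_A x * h x)%:E).
Proof.
move=> mA Afin mh hC.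
apply: (@le_integrable _ _ _ _ _ _ _ (fun x => (C * \1_A x)%:E)) => //.
- apply/measurable_EFinP; exact: measurable_funM.
- move=> x _ /=; rewrite lee_fin !normrM indicE.
  have [/set_mem Ax|] := boolP (x \in A); rewrite ?normr0 ?mul0r ?mulr0 //.
  by rewrite normr1 mul1r mulr1 (le_trans (hC _ Ax)) // ler_norm.
- under eq_fun do rewrite EFinM.
  apply: integrableZl => //; apply/integrableP; split; first exact/measurable_EFinP.
  rewrite (eq_integral (fun x => (\1_A x)%:E)) ?integral_indic ?setIT //.
  by move=> x _; rewrite gee0_abs // lee_fin.
Qed.

Lemma convex_setE (K : set (R * R)) : convex_set K ->
  forall x y l, K x -> K y -> 0 <= l -> l <= 1 -> K (l *: x + (1 - l) *: y).
Proof.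
move=> cK x y l Kx Ky l0 l1.
by have /(_ (mem_set Kx) (mem_set Ky)) /set_mem := cK x y (Itv01 l0 l1).
Qed.

Lemma rot_continuous theta : continuous (rot theta : R * R -> R * R).
Proof.
case=> a b; rewrite /rot.
apply: (@continuousD _ _ _ (fun q : R * R => q.1 *: theta)
  (fun q : R * R => q.2 *: (- theta.2, theta.1))); apply: continuousZl.
  exact: cvg_fst.
exact: cvg_snd.
Qed.

Lemma closed_interval_set (S : set R) : compact S -> S !=set0 ->
  (forall x y z, S x -> S y -> x <= z <= y -> S z) ->
  exists a b, a <= b /\ S = `[a, b]%classic.
Proof.
move=> cS S0 iS.
have ci : {within S, continuous (id : R -> R)}.
  by apply: continuous_subspaceT => x; exact: cvg_id.
have [b /set_mem Sb bmax] := compact_EVT_max S0 cS ci.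
have [a /set_mem Sa amin] := compact_EVT_min S0 cS ci.
exists a, b; split; first exact/(bmax a)/mem_set.
apply/seteqP; split => z /=; rewrite in_itv /=; last exact: iS.
by move=> /mem_set Sz; rewrite (amin z Sz) /= (bmax z Sz).
Qed.

Section Rotated.
Variables (theta : R * R) (K : set (R * R)) (h : R * R -> R).
Hypotheses (ct : circle theta) (bK : bounded_set K) (cK : closed K).
Hypothesis ch : continuous h.

Lemma measurable_rot_preimage : measurable (rot theta @^-1` K : set plane).
Proof.
apply: closed_measurable2; apply: closed_comp => // x _; exact: rot_continuous.
Qed.

Lemma lebesgue2_rot_lty : (@lebesgue2 R (rot theta @^-1` K) < +oo)%E.
Proof.
have mK := closed_measurable2 cK.
by rewrite (area_preserving_rot ct).2 //; exact: lebesgue2_bounded_lty.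
Qed.

Lemma integrable_rot : (@lebesgue2 R).-integrable setT
  (fun p => (\1_K (rot theta p) * h (rot theta p))%:E).
Proof.
have [C hC] := continuous_bounded (bounded_closed_compact2 bK cK) ch.
apply: (@integrable_indicM (rot theta @^-1` K) (h \o rot theta) C).
- exact: measurable_rot_preimage.
- exact: lebesgue2_rot_lty.
- apply: continuous_measurable2 => p; apply: continuous_comp; last exact: ch.
  exact: rot_continuous.
- by move=> p Kp; exact: hC.
Qed.

Lemma integrable_plane : (@lebesgue2 R).-integrable setT (fun p => (\1_K p * h p)%:E).
Proof.
have [C hC] := continuous_bounded (bounded_closed_compact2 bK cK) ch.
have mK := closed_measurable2 cK.
apply: (@integrable_indicM K h C) => //; last exact: continuous_measurable2.
exact: lebesgue2_bounded_lty.
Qed.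

(** Fubini after a rotation: the plane integral over the set is the iterated
    integral over the parallel lines that the Radon transform uses. *)
Lemma integral_rot :
  (\int[@lebesgue2 R]_p (\1_K p * h p)%:E =
   \int[lambda]_s \int[lambda]_t
     (\1_K (rot theta (s, t)) * h (rot theta (s, t)))%:E)%E.
Proof.
have [mr Er] := area_preserving_rot ct.
transitivity (\int[pushforward (@lebesgue2 R) (rot theta : plane -> plane)]_p
  (\1_K p * h p)%:E)%E.
  by apply: eq_measure_integral => A mA _; exact/esym/Er.
rewrite integral_pushforward //=.
- by rewrite preimage_setT -(integral12_prod_meas1 integrable_rot).
- exact: measurable_int integrable_plane.
- by rewrite preimage_setT; exact: integrable_rot.
Qed.

End Rotated.

End BoundedPlaneSets.

(** * Directional derivatives integrated over a convex set *)

Section DirectionalIntegral.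
Variable R : realType.
Local Notation line := (measurableTypeR R).
Local Notation plane := (line * line)%type.
Local Notation lambda := (@lebesgue_measure R).

Lemma integral_derive (F f : R -> R) (a b : R) : a <= b ->
  (forall x : R, is_derive x 1 F (f x)) -> continuous f ->
  (\int[lambda]_(x in `[a, b]) (f x)%:E = (F b - F a)%:E)%E.
Proof.
move=> ab DF cf; have cF : continuous F.
  by move=> x; apply/differentiable_continuous/derivable1_diffP; case: (DF x).
have [->|nab] := eqVneq a b.
  by rewrite set_itv1 integral_set1 subrr.
rewrite (@continuous_FTC2 _ f F) ?EFinB //.
- by rewrite lt_neqAle nab.
- exact: continuous_subspaceT.
- split; first by move=> x _; case: (DF x).
    exact/cvg_at_right_filter/cF.
  exact/cvg_at_left_filter/cF.
- by move=> x _; rewrite derive1E; case: (DF x).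
Qed.

Lemma integral_indicM d (T : measurableType d) (mu : {measure set T -> \bar R})
    (A : set T) (g : T -> R) :
  (\int[mu]_x (\1_A x * g x)%:E = \int[mu]_(x in A) (g x)%:E)%E.
Proof.
rewrite [RHS]integral_mkcond; apply: eq_integral => x _.
by rewrite indicE patchE; case: ifPn => _; rewrite ?mul1r ?mul0r.
Qed.

Lemma integral_cst_itv (c a b : R) : a <= b ->
  (\int[lambda]_(x in `[a, b]) c%:E = (c * (b - a))%:E)%E.
Proof.
move=> ab.
have DF (x : R) : is_derive x 1 (fun y : R => c * y) c.
  apply: DeriveDef; first exact: derivableM.
  rewrite (@deriveM _ _ (fun=> c) id x 1) //.
  by rewrite derive_id derive_cst scaler0 addr0 [_ *: _]mulr1.
rewrite (integral_derive ab DF) -?mulrBr //; by move=> x; exact: cst_continuous.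
Qed.

Lemma integral_cst_band (c w D : R) : 0 <= D ->
  (\int[lambda]_s (c * \1_(`[w, w + D]%classic : set R) s)%:E = (c * D)%:E)%E.
Proof.
move=> D0; under eq_integral do rewrite mulrC.
rewrite (integral_indicM lambda (`[w, w + D]%classic : set R) (fun=> c)).
by rewrite integral_cst_itv ?lerDl // addrAC subrr add0r.
Qed.

Lemma enorm_ge0 (x : R * R) : 0 <= enorm x.
Proof. exact: sqrtr_ge0. Qed.

Lemma enorm_rot (theta p q : R * R) : circle theta ->
  enorm (rot theta p - rot theta q) = enorm (p - q).
Proof.
move=> /circleP ct; rewrite /enorm !rotE /=; congr Num.sqrt.
rewrite -[RHS]mul1r -ct; ring.
Qed.

Lemma ler_norm1_enorm (p : R * R) : `|p.1| <= enorm p.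
Proof. by rewrite /enorm -sqrtr_sqr ler_sqrt ?lerDl ?addr_ge0 ?sqr_ge0. Qed.

Lemma ler_norm2_enorm (p : R * R) : `|p.2| <= enorm p.
Proof. by rewrite /enorm -sqrtr_sqr ler_sqrt ?lerDr ?addr_ge0 ?sqr_ge0. Qed.

Lemma rot_coords (theta p : R * R) : circle theta -> 
  p.1 = theta.1 * (rot theta p).1 + theta.2 * (rot theta p).2 /\
  p.2 = theta.1 * (rot theta p).2 - theta.2 * (rot theta p).1.
Proof.
move=> /circleP ct; rewrite rotE /=.
by split; rewrite -[LHS]mul1r -ct; ring.
Qed.

Lemma circle_le1 (theta : R * R) : circle theta -> `|theta.1| <= 1 /\ `|theta.2| <= 1.
Proof. by move=> ct; rewrite -[1]ct ler_norm1_enorm ler_norm2_enorm. Qed.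

Lemma rot_line_continuous (theta : R * R) (s : R) :
  continuous (fun t : R => rot theta (s, t)).
Proof.
move=> t; apply: (@continuous_comp _ _ _ (fun t : R => (s, t)) (rot theta)).
  apply: (@cvg_pair _ _ _ (nbhs t) (nbhs s) (nbhs t) _ _ _ (fun=> s) id);
     [exact: cvg_cst | exact: cvg_id].
exact: rot_continuous.
Qed.

Lemma rot_line_conv (theta : R * R) s x y l :
  l *: rot theta (s, x) + (1 - l) *: rot theta (s, y) =
  rot theta (s, l * x + (1 - l) * y).
Proof.
rewrite !rotE /=; case: theta => c d /=; congr pair.
  by change (l * (c * s - d * x) + (1 - l) * (c * s - d * y) =
    c * s - d * (l * x + (1 - l) * y)); ring.
by change (l * (d * s + c * x) + (1 - l) * (d * s + c * y) =
  d * s + c * (l * x + (1 - l) * y)); ring.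
Qed.

Section Convex.
Variables (K : set (R * R)) (D : R).
Hypotheses (bK : bounded_set K) (cK : closed K) (vK : convex_set K).
Hypotheses (D0 : 0 <= D) (DK : forall x y, K x -> K y -> enorm (x - y) <= D).

Lemma slice_interval theta s : circle theta ->
  (exists t, K (rot theta (s, t))) ->
  exists a b, a <= b /\ [set t | K (rot theta (s, t))] = `[a, b]%classic.
Proof.
move=> ct neS; apply: closed_interval_set => //.
  have [M M0 KM] := bounded_box bK.
  apply: (@subclosed_compact _ _ (`[- (M + M), M + M]%classic : set R)).
  - rewrite -[X in closed X]/((fun t => rot theta (s, t)) @^-1` K).
    apply: closed_comp => // t _.
    exact: rot_line_continuous.
  - exact: segment_compact.
  - move=> t /KM; have [_] := rot_coords (s, t) ct; rewrite [(s, t).2]/=.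
    set p := rot _ _ => t2 [p1 p2].
    rewrite /= in_itv /= -ler_norml t2 (le_trans (ler_normB _ _)) // !normrM.
    have [h1 h2] := circle_le1 ct.
    by apply: lerD; rewrite -[leRHS]mul1r ler_pM.
move=> x y z /= Kx Ky /andP[xz zy].
have [xy|xy] := eqVneq x y.
  by rewrite (_ : z = x) //; apply/eqP; rewrite eq_le xz {1}xy zy.
have xy0 : 0 < y - x by rewrite subr_gt0 lt_neqAle xy (le_trans xz).
pose l := (y - z) / (y - x).
have l0 : 0 <= l by rewrite divr_ge0 ?(ltW xy0) ?subr_ge0.
have l1 : l <= 1 by rewrite ler_pdivrMr // mul1r lerD2l lerN2.
have := convex_setE vK Kx Ky l0 l1; rewrite rot_line_conv; congr (K (rot _ (_, _))).
by rewrite /l; field; rewrite gt_eqF.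
Qed.

(** Offsets of lines of one direction that meet the set differ by at most the
    distance between two points of the set. *)
Lemma shadow_interval theta : circle theta ->
  exists w, forall s t, K (rot theta (s, t)) -> w <= s <= w + D.
Proof.
move=> ct; pose W := [set s | exists t, K (rot theta (s, t))].
have [W0|/set0P[s0 [t0 K0]]] := eqVneq W set0.
  exists 0 => s t Kst; have : W s by exists t.
  by rewrite W0.
have Wle s s' : W s -> W s' -> s - D <= s'.
  move=> [t Kt] [t' Kt']; rewrite lerBlDr -lerBlDl (le_trans (ler_norm _)) //.
  apply: le_trans (DK Kt Kt'); rewrite enorm_rot //.
  exact: (ler_norm1_enorm ((s, t) - (s', t'))).
have lW s : W s -> lbound W (s - D) by move=> Ws s' /(Wle _ _ Ws).
exists (inf W) => s t Kst; have Ws : W s by exists t.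
rewrite ge_inf //; last by exists (s - D); exact: lW.
by rewrite -lerBlDr; apply: lb_le_inf (lW _ Ws); exists s.
Qed.

Lemma is_derive_rot theta (psi : R * R -> R) s : Ck [:: e1 R; e2 R] 1 psi ->
  forall t : R, is_derive t 1 (fun t => psi (rot theta (s, t)))
   (- theta.2 * 'D_(e1 R) psi (rot theta (s, t)) +
    theta.1 * 'D_(e2 R) psi (rot theta (s, t))).
Proof.
move=> Cpsi t; have [dv <-] := is_derive_C1 (- theta.2, theta.1) (rot theta (s, t)) Cpsi.
have E : (fun h : R => h^-1 *: (psi (rot theta (s, h *: 1 + t)) - psi (rot theta (s, t)))) =
    (fun h => h^-1 *: (psi (h *: (- theta.2, theta.1) + rot theta (s, t)) - psi (rot theta (s, t)))).
  apply/funext => h; congr (_ *: (psi _ - _)); rewrite /rot /= addrCA; congr (_ + _).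
  by rewrite scalerDl [h *: 1]mulr1.
by apply: DeriveDef; [rewrite /derivable E | rewrite /derive E].
Qed.

Lemma Ck1_partials (psi : R * R -> R) : Ck [:: e1 R; e2 R] 1 psi ->
  Ck [:: e1 R; e2 R] 0 ('D_(e1 R) psi) /\ Ck [:: e1 R; e2 R] 0 ('D_(e2 R) psi).
Proof.
move=> [_ Cf].
have m2 : e2 R \in [:: e1 R; e2 R] by rewrite !inE eqxx orbT.
split; [exact: (Cf _ (mem_head _ _)).2 | exact: (Cf _ m2).2].
Qed.

Lemma derive_field_continuous (a b : R) (psi : R * R -> R) :
  Ck [:: e1 R; e2 R] 1 psi ->
  continuous (fun x => a * 'D_(e1 R) psi x + b * 'D_(e2 R) psi x).
Proof.
by move=> /Ck1_partials[c1 c2]; apply: (Ck_continuous (CkD (CkZ a c1) (CkZ b c2))).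
Qed.

Lemma slice_integral_le theta (psi : R * R -> R) (M w s : R) :
  circle theta -> Ck [:: e1 R; e2 R] 1 psi -> 0 <= M ->
  (forall x, K x -> `|psi x| <= M) ->
  (forall s t, K (rot theta (s, t)) -> w <= s <= w + D) ->
  (`| \int[lambda]_t (\1_K (rot theta (s, t)) *
      (- theta.2 * 'D_(e1 R) psi (rot theta (s, t)) +
       theta.1 * 'D_(e2 R) psi (rot theta (s, t))))%:E |
   <= ((M + M) * \1_(`[w, w + D]%classic : set R) s)%:E)%E.
Proof.
move=> ct Cpsi M0 psiM Kw.
have cg := @derive_field_continuous (- theta.2) theta.1 _ Cpsi.
rewrite (integral_indicM lambda [set t | K (rot theta (s, t))]).
have [neS|/forallNP S0] := pselect (exists t, K (rot theta (s, t))); last first.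
  rewrite (_ : [set t | K (rot theta (s, t))] = set0); last first.
    by apply/seteqP; split => // t; exact: S0.
  by rewrite integral_set0 abse0 lee_fin mulr_ge0 ?addr_ge0.
have [a [b [ab Sab]]] := slice_interval ct neS.
have [t0 /Kw Kt0] := neS.
rewrite Sab (integral_derive ab (@is_derive_rot theta psi s Cpsi)); last first.
  move=> t; apply: (@continuous_comp _ _ _ (fun t : R => rot theta (s, t))
    (fun x => - theta.2 * 'D_(e1 R) psi x + theta.1 * 'D_(e2 R) psi x)).
    exact: rot_line_continuous.
  exact: cg.
rewrite indicE mem_set ?mulr1 /= ?in_itv // lee_fin.
have Kc c : c \in `[a, b] -> `|psi (rot theta (s, c))| <= M.
  by move=> cab; apply: psiM; have : `[a, b]%classic c by []; rewrite -Sab.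
apply: (le_trans (ler_normB _ _)); apply: lerD; apply: Kc.
  by rewrite in_itv /= ab lexx.
by rewrite in_itv /= ab lexx.
Qed.

(** The integral over a line of a directional derivative telescopes to the
    difference of two boundary values, and the lines of a given direction that
    meet the set form a band of width at most its diameter. *)
Lemma directional_integral_le theta (psi : R * R -> R) (M : R) :
  circle theta -> Ck [:: e1 R; e2 R] 1 psi -> 0 <= M ->
  (forall x, K x -> `|psi x| <= M) ->
  (`| \int[@lebesgue2 R]_x (\1_K x *
      (- theta.2 * 'D_(e1 R) psi x + theta.1 * 'D_(e2 R) psi x))%:E |
   <= ((M + M) * D)%:E)%E.
Proof.
move=> ct Cpsi M0 psiM.
have cg := @derive_field_continuous (- theta.2) theta.1 _ Cpsi.
have [w Kw] := shadow_interval ct.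
rewrite (integral_rot ct bK cK cg).
have iF := integrable_fubini_F (integrable_rot ct bK cK cg).
apply: le_trans (le_abse_integral _ measurableT (measurable_int _ iF)) _.
have mI : measurable (`[w, w + D]%classic : set R) by exact: measurable_itv.
apply: (@le_trans _ _ (\int[lambda]_s ((M + M) * \1_(`[w, w + D]%classic : set R) s)%:E)%E).
  apply: ge0_le_integral => //.
  - exact/measurableT_comp/measurable_int/iF.
  - by apply/measurable_EFinP; apply: measurable_funM.
  - by move=> s _; exact: slice_integral_le.
by rewrite integral_cst_band.
Qed.

End Convex.
End DirectionalIntegral.

(** * A Crofton inequality *)

Section Crofton.
Variable R : realType.
Local Notation line := (measurableTypeR R).
Local Notation plane := (line * line)%type.
Local Notation lambda := (@lebesgue_measure R).

Lemma integral_abs_split (S F : R -> R) (a b c : R) : a <= b -> b <= c ->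
  (forall x : R, is_derive x 1 S (F x)) -> continuous F ->
  ((`|S b - S a| + `|S c - S b|)%:E <= \int[lambda]_(t in `[a, c]) (`|F t|)%:E)%E.
Proof.
move=> ab bc DS cF.
have mF D : measurable_fun D (fun t : R => (`|F t|)%:E).
  apply/measurable_EFinP; apply: measurable_funTS.
  apply: continuous_measurable_fun => t.
  by apply: (@continuous_comp _ _ _ F Num.norm); [exact: cF | exact: norm_continuous].
have mG D : measurable_fun D (fun t : R => (F t)%:E).
  by apply/measurable_EFinP; apply: measurable_funTS; exact: continuous_measurable_fun.
rewrite (_ : `[a, c]%classic = `[a, b[%classic `|` `[b, c]%classic); last first.
  by rewrite -itv_bndbnd_setU // bnd_simp.
rewrite ge0_integral_setU //.
- rewrite integral_itv_bndo_bndc // EFinD; apply: leeD.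
  + rewrite -[X in (X <= _)%E](_ : `|\int[lambda]_(t in `[a, b]) (F t)%:E|%E = _).
      exact: (le_abse_integral lambda (measurable_itv _) (mG _)).
    by rewrite (integral_derive ab DS cF).
  + rewrite -[X in (X <= _)%E](_ : `|\int[lambda]_(t in `[b, c]) (F t)%:E|%E = _).
      exact: (le_abse_integral lambda (measurable_itv _) (mG _)).
    by rewrite (integral_derive bc DS cF).
- exact: mF.
- apply/disj_setPS => t /=; rewrite !in_itv /= => -[/andP[_ tb] /andP[bt _]].
  by move: tb; rewrite ltNge bt.
Qed.

(** With [r] the length of [(a1, a2)], the primitive [S] of the integrand has
    values [- a2] at 0 and [a2] at [pi], and it reaches [r] at an intermediate
    zero of the integrand; the two increments add up to [2 r]. *)
Lemma integral_abs_trig (a1 a2 : R) :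
  ((2 * enorm (a1, a2))%:E <=
   \int[lambda]_(t in `[0%R, pi]) (`|cos t * a1 + sin t * a2|)%:E)%E.
Proof.
wlog a10 : a1 a2 / 0 <= a1.
  move=> H; have [/H //|/ltW a10] := leP 0 a1.
  have := H (- a1) (- a2); rewrite oppr_ge0 => /(_ a10).
  rewrite /enorm /= !sqrrN; move=> /le_trans; apply.
  rewrite le_eqVlt; apply/orP; left; apply/eqP; apply: eq_integral => t _.
  by rewrite !mulrN -opprD normrN.
set r := enorm _.
have [r0|r0] := eqVneq r 0.
  by rewrite r0 mulr0; apply: integral_ge0 => t _; rewrite lee_fin.
have rp : 0 < r by rewrite lt_neqAle eq_sym r0 sqrtr_ge0.
have rE : r ^+ 2 = a1 ^+ 2 + a2 ^+ 2 by rewrite sqr_sqrtr // addr_ge0 ?sqr_ge0.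
have a2r : `|a2| <= r by exact: (@ler_norm2_enorm _ (a1, a2)).
have xI : -1 <= - a2 / r <= 1.
  by rewrite ler_pdivlMr // ler_pdivrMr // mulN1r mul1r -ler_norml normrN ?a2r.
pose F t := cos t * a1 + sin t * a2.
pose S t := sin t * a1 - cos t * a2.
have DS (t : R) : is_derive t 1 S (F t).
  have h1 := is_deriveM (is_derive_sin t) (is_derive_cst a1 t 1).
  have h2 := is_deriveM (is_derive_cos t) (is_derive_cst a2 t 1).
  apply: (is_derive_eq (is_deriveB h1 h2)).
  by rewrite /F /GRing.scale /= !mulr0 !add0r mulrN opprK mulrC [a2 * _]mulrC.
have cF : continuous F.
  move=> t; apply: (@continuousD _ _ _ (fun t : R => cos t * a1) (fun t => sin t * a2));
    apply: continuousM; try exact: cst_continuous.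
    exact: continuous_cos.
  exact: continuous_sin.
(* A zero of the integrand [F]. *)
pose b := acos (- a2 / r).
have cb : cos b = - a2 / r by rewrite acosK.
have sb : sin b = a1 / r.
  rewrite sin_acos // (_ : 1 - _ = (a1 / r) ^+ 2).
    by rewrite sqrtr_sqr ger0_norm // divr_ge0 // ltW.
  by rewrite !expr_div_n sqrrN -[X in X - _](divff (expf_neq0 2 r0)) -mulrBl {1}rE addrK.
have Sb : S b = r.
  rewrite /S sb cb mulNr mulNr opprK mulrAC [a2 / r * _]mulrAC -mulrDl.
  by rewrite -!expr2 -rE expr2 mulfK.
have := integral_abs_split (acos_ge0 xI) (acos_lepi xI) DS cF.
apply: le_trans; rewrite lee_fin -/b Sb /S sin0 cos0 sinpi cospi.
rewrite !mul0r !mul1r mulN1r !sub0r !opprK.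
apply: (@le_trans _ _ ((r + a2) + (r - a2))); last first.
  by apply: lerD; [exact: ler_norm | rewrite distrC; exact: ler_norm].
by rewrite le_eqVlt; apply/orP; left; apply/eqP; ring.
Qed.

Lemma dot_le_enorm (p q : R * R) : p.1 * q.1 + p.2 * q.2 <= enorm p * enorm q.
Proof.
apply: (le_trans (ler_norm _)).
rewrite /enorm -sqrtrM ?addr_ge0 ?sqr_ge0 // -sqrtr_sqr ler_wsqrtr // -subr_ge0.
rewrite (_ : _ - _ = (p.1 * q.2 - p.2 * q.1) ^+ 2) ?sqr_ge0 //; ring.
Qed.

Lemma derive_lincomb m (c : 'I_m -> R) (W : 'I_m -> R * R -> R) (e x : R * R) :
  (forall i, derivable (W i) x e) ->
  'D_e (fun x => \sum_i c i * W i x) x = \sum_i c i * 'D_e (W i) x.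
Proof.
move=> dW.
rewrite (_ : (fun x => _) = \sum_i (c i \*: W i)); last first.
  by apply/funext => y; rewrite fct_sumE.
rewrite derive_sum => [|i]; last exact: derivableZ.
by apply: eq_bigr => i _; rewrite deriveZ.
Qed.

Lemma Ck1_derivable (psi : R * R -> R) x : Ck [:: e1 R; e2 R] 1 psi ->
  derivable psi x (e1 R) /\ derivable psi x (e2 R).
Proof.
move=> [_ Cf].
have m2 : e2 R \in [:: e1 R; e2 R] by rewrite !inE eqxx orbT.
split; [exact: (Cf _ (mem_head _ _)).1 | exact: (Cf _ m2).1].
Qed.

Section Convex.
Variables (K : set (R * R)) (D : R).
Hypotheses (bK : bounded_set K) (cK : closed K) (vK : convex_set K).
Hypotheses (D0 : 0 <= D) (DK : forall x y, K x -> K y -> enorm (x - y) <= D).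

Local Notation pint h := (\int[@lebesgue2 R]_(x in K) h x).

Lemma integrable_on (h : R * R -> R) : continuous h ->
  (@lebesgue2 R).-integrable K (EFin \o h).
Proof.
move=> ch; have mK := closed_measurable2 cK.
have := integrable_plane bK cK ch.
move=> /(integrableS measurableT mK (@subsetT _ _)).
apply: le_integrable => //.
  apply/measurable_EFinP; apply: measurable_funTS; exact: continuous_measurable2.
by move=> x Kx /=; rewrite indicE mem_set // mul1r.
Qed.

Lemma integral_indic_plane (h : R * R -> R) : continuous h ->
  (\int[@lebesgue2 R]_x (\1_K x * h x)%:E = (pint h)%:E)%E.
Proof.
move=> ch; have mK := closed_measurable2 cK.
rewrite (integral_indicM (@lebesgue2 R) K) /Rintegral fineK //.
by apply: integrable_fin_num => //; exact: integrable_on.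
Qed.

Lemma pint_lin2 (a b : R) (h1 h2 : R * R -> R) : continuous h1 -> continuous h2 ->
  pint (fun x => a * h1 x + b * h2 x) = a * pint h1 + b * pint h2.
Proof.
move=> c1 c2; have mK := closed_measurable2 cK.
have cZ (k : R) h : continuous h -> continuous (fun x : R * R => k * h x).
  by move=> ch x; apply: continuousM; [exact: cst_continuous | exact: ch].
rewrite RintegralD //; try by apply: integrable_on; exact: cZ.
by rewrite !RintegralZl //; exact: integrable_on.
Qed.

Lemma pint_sum m (c : 'I_m -> R) (h : 'I_m -> R * R -> R) :
  (forall i, continuous (h i)) ->
  pint (fun x => \sum_i c i * h i x) = \sum_i c i * pint (h i).
Proof.
move=> ch; have mK := closed_measurable2 cK.
have Ch i : Ck [:: e1 R; e2 R] 0 (h i) by split.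
have cZ i : continuous (fun x : R * R => c i * h i x).
  exact: (Ck_continuous (CkZ (c i) (Ch i))).
elim: (index_enum _) => [|i s IH].
  under eq_Rintegral do rewrite big_nil.
  by rewrite Rintegral_cst // mul0r big_nil.
under eq_Rintegral do rewrite big_cons.
rewrite RintegralD //; last 2 first.
- exact: integrable_on.
- apply: integrable_on.
  by apply: (Ck_continuous (@Ck_sum _ _ [:: e1 R; e2 R] 0 _ _ _ _ _)) => j; exact: CkZ.
by rewrite big_cons IH RintegralZl //; exact: integrable_on.
Qed.

Lemma directional_pint_le (psi : R * R -> R) (M c d : R) :
  c ^+ 2 + d ^+ 2 = 1 -> Ck [:: e1 R; e2 R] 1 psi -> 0 <= M ->
  (forall x, K x -> `|psi x| <= M) ->
  `|c * pint ('D_(e1 R) psi) + d * pint ('D_(e2 R) psi)| <= (M + M) * D.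
Proof.
move=> cd Cpsi M0 psiM.
have [C1 C2] := Ck1_partials Cpsi.
have ct : circle (d, - c) by apply/circleP; rewrite /= sqrrN addrC.
have := directional_integral_le bK cK vK D0 DK ct Cpsi M0 psiM.
rewrite /= opprK (integral_indic_plane (@derive_field_continuous _ c d _ Cpsi)) lee_fin.
rewrite pint_lin2 //; [exact: Ck_continuous C1 | exact: Ck_continuous C2].
Qed.

Section CroftonSum.
Variables (m : nat) (W : 'I_m -> R * R -> R) (u : 'I_m -> R * R) (M : R).
Hypotheses (CW : forall i, Ck [:: e1 R; e2 R] 1 (W i)) (M0 : 0 <= M).
Hypotheses (W0 : forall i x, K x -> 0 <= W i x).
Hypotheses (WM : forall x, K x -> \sum_i enorm (u i) * W i x <= M).

Let A1 i := pint ('D_(e1 R) (W i)).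
Let A2 i := pint ('D_(e2 R) (W i)).

(** Attaching to each [W i] the sign of its term gives one function that is still
    bounded by [M] on the set, hence a single directional integral to bound. *)
Lemma crofton_direction (c d : R) : c ^+ 2 + d ^+ 2 = 1 ->
  \sum_i enorm (u i) * `|c * A1 i + d * A2 i| <= (M + M) * D.
Proof.
move=> cd.
pose k i : R := Num.sg (c * A1 i + d * A2 i) * enorm (u i).
have dW1 x i : derivable (W i) x (e1 R) by have [] := Ck1_derivable x (CW i).
have dW2 x i : derivable (W i) x (e2 R) by have [] := Ck1_derivable x (CW i).
have c1 i : continuous ('D_(e1 R) (W i)).
  by have [C1 _] := Ck1_partials (CW i); exact: Ck_continuous C1.
have c2 i : continuous ('D_(e2 R) (W i)).
  by have [_ C2] := Ck1_partials (CW i); exact: Ck_continuous C2.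
have Cpsi : Ck [:: e1 R; e2 R] 1 (fun x => \sum_i k i * W i x).
  by apply: Ck_sum => i; exact: CkZ.
have psiM x : K x -> `|\sum_i k i * W i x| <= M.
  move=> Kx; apply: le_trans (WM Kx); apply: le_trans (ler_norm_sum _ _ _) _.
  apply: ler_sum => i _; rewrite !normrM (ger0_norm (W0 _ Kx)).
  apply: ler_wpM2r; first exact: W0.
  rewrite normr_sg (ger0_norm (enorm_ge0 _)).
  by case: (_ != 0); rewrite ?mul1r ?mul0r ?enorm_ge0.
have := directional_pint_le cd Cpsi M0 psiM.
have -> : 'D_(e1 R) (fun x => \sum_i k i * W i x) = fun x => \sum_i k i * 'D_(e1 R) (W i) x.
  by apply/funext => x; rewrite derive_lincomb.
have -> : 'D_(e2 R) (fun x => \sum_i k i * W i x) = fun x => \sum_i k i * 'D_(e2 R) (W i) x.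
  by apply/funext => x; rewrite derive_lincomb.
rewrite (pint_sum k c1) (pint_sum k c2) => /(le_trans (ler_norm _)); apply: le_trans.
rewrite !mulr_sumr -big_split /=; apply: ler_sum => i _.
rewrite normrEsg /k -/(A1 i) -/(A2 i) le_eqVlt; apply/orP; left; apply/eqP.
by ring.
Qed.

(** Averaging the previous bound over all directions turns each term into the
    length of its integrated gradient, because the mean of the absolute value of
    the cosine is [2 / pi]. *)
Lemma crofton_sum : \sum_i ((u i).1 * A1 i + (u i).2 * A2 i) <= pi * D * M.
Proof.
have mI : measurable (`[0, pi]%classic : set R) by exact: measurable_itv.
have mA i : measurable_fun (`[0, pi]%classic : set R)
    (fun t : R => `|cos t * A1 i + sin t * A2 i|).
  apply: measurable_funTS; apply: measurableT_comp => //.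
  by apply: measurable_funD; apply: measurable_funM => //;
    apply: continuous_measurable_fun; [exact: continuous_cos | exact: continuous_sin].
have mF i : measurable_fun (`[0, pi]%classic : set R)
    (fun t : R => (enorm (u i) * `|cos t * A1 i + sin t * A2 i|)%:E).
  by apply/measurable_EFinP; exact: measurable_funM.
have H1 : (\int[lambda]_(t in `[0%R, pi])
    \sum_i (enorm (u i) * `|cos t * A1 i + sin t * A2 i|)%:E <= (pi * ((M + M) * D))%:E)%E.
  apply: (@le_trans _ _ (\int[lambda]_(t in `[0%R, pi]) ((M + M) * D)%:E)%E).
    apply: ge0_le_integral => //.
    - by move=> t _; apply: sume_ge0 => i _; rewrite lee_fin mulr_ge0 ?enorm_ge0.
    - exact: emeasurable_sum.
    - move=> t _; rewrite sumEFin lee_fin; apply: crofton_direction.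
      exact: cos2Dsin2.
  by rewrite integral_cst_itv ?pi_ge0 // subr0 mulrC.
have H2 : ((\sum_i enorm (u i) * (2 * enorm (A1 i, A2 i)))%:E <=
   \int[lambda]_(t in `[0%R, pi])
    \sum_i (enorm (u i) * `|cos t * A1 i + sin t * A2 i|)%:E)%E.
  rewrite ge0_integral_sum //; last first.
    by move=> i t _; rewrite lee_fin mulr_ge0 ?enorm_ge0.
  rewrite -sumEFin; apply: lee_sum => i _.
  under eq_integral do rewrite EFinM.
  rewrite ge0_integralZl //; last first.
  - by rewrite lee_fin enorm_ge0.
  - by apply/measurable_EFinP; exact: mA.
  - by rewrite EFinM lee_wpmul2l ?lee_fin ?enorm_ge0 //; exact: integral_abs_trig.
have := le_trans H2 H1; rewrite lee_fin.
have -> : pi * ((M + M) * D) = 2 * (pi * D * M) by ring.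
under eq_bigr do rewrite mulrCA.
rewrite -mulr_sumr ler_pM2l //; apply: le_trans; apply: ler_sum => i _.
exact: (@dot_le_enorm (u i) (A1 i, A2 i)).
Qed.

End CroftonSum.

End Convex.
End Crofton.

(** * Decomposition of a vector field by a random walk *)

Section Walk.
Variables (R : realType) (f g : R * R -> R).
Hypotheses (Cf : Ck [:: e1 R; e2 R] 1 f) (Cg : Ck [:: e1 R; e2 R] 1 g).

Definition branch (a b : R) (wu : (R * R -> R) * (R * R)) : (R * R -> R) * (R * R) :=
  (fun x => (1 + a * f x) / 2 * ((1 + b * g x) / 2) * wu.1 x, wu.2 + (a, b)).

(** The law after [n] steps of the random walk whose steps are [(1, 1)],
    [(1, -1)], [(-1, 1)], [(-1, -1)], with independent coordinates of means
    [f x] and [g x]: one entry per path, with its probability as a function of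
    [x] and its end point. *)
Fixpoint walk (n : nat) : seq ((R * R -> R) * (R * R)) :=
  if n is m.+1 then
    map (branch 1 1) (walk m) ++ map (branch 1 (-1)) (walk m) ++
    map (branch (-1) 1) (walk m) ++ map (branch (-1) (-1)) (walk m)
  else [:: (fun=> 1, (0, 0))].

Definition walk_mean n (F : R * R -> R) x : R :=
  \sum_(wu <- walk n) wu.1 x * F wu.2.

Lemma walk_meanS n F x : walk_mean n.+1 F x =
  (1 + f x) / 2 * ((1 + g x) / 2) * walk_mean n (fun u => F (u + (1, 1))) x +
  (1 + f x) / 2 * ((1 - g x) / 2) * walk_mean n (fun u => F (u + (1, -1))) x +
  (1 - f x) / 2 * ((1 + g x) / 2) * walk_mean n (fun u => F (u + (-1, 1))) x +
  (1 - f x) / 2 * ((1 - g x) / 2) * walk_mean n (fun u => F (u + (-1, -1))) x.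
Proof.
rewrite /walk_mean /= !big_cat !big_map /= !addrA.
congr (_ + _ + _ + _); rewrite mulr_sumr; apply: eq_bigr => wu _;
  by rewrite !(mul1r, mulN1r) !mulrA.
Qed.

Lemma walk_meanD n F G x :
  walk_mean n (fun u => F u + G u) x = walk_mean n F x + walk_mean n G x.
Proof. by rewrite -big_split; apply: eq_bigr => wu _; rewrite mulrDr. Qed.

Lemma walk_meanZ n c F x : walk_mean n (fun u => c * F u) x = c * walk_mean n F x.
Proof. by rewrite /walk_mean mulr_sumr; apply: eq_bigr => wu _; rewrite mulrCA. Qed.

Lemma walk_mean1 n x : walk_mean n (fun=> 1) x = 1.
Proof.
elim: n => [|n IH]; first by rewrite /walk_mean big_seq1 mulr1.
by rewrite walk_meanS IH; field.
Qed.

Lemma walk_mean_cst n c x : walk_mean n (fun=> c) x = c.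
Proof.
by have := walk_meanZ n c (fun=> 1) x; rewrite walk_mean1 !mulr1.
Qed.

Lemma walk_mean_shift_fst n a b x :
  walk_mean n (fun u => (u + (a, b)).1) x = walk_mean n fst x + a.
Proof. by rewrite -[a in RHS](walk_mean_cst n a x) -walk_meanD. Qed.

Lemma walk_mean_fst n x : walk_mean n fst x = n%:R * f x.
Proof.
elim: n => [|n IH]; first by rewrite /walk_mean big_seq1 mulr0 mul0r.
by rewrite walk_meanS !walk_mean_shift_fst IH -natr1; field.
Qed.

Lemma walk_mean_shift_snd n a b x :
  walk_mean n (fun u => (u + (a, b)).2) x = walk_mean n snd x + b.
Proof. by rewrite -[b in RHS](walk_mean_cst n b x) -walk_meanD. Qed.

Lemma walk_mean_snd n x : walk_mean n snd x = n%:R * g x.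
Proof.
elim: n => [|n IH]; first by rewrite /walk_mean big_seq1 mulr0 mul0r.
by rewrite walk_meanS !walk_mean_shift_snd IH -natr1; field.
Qed.

(** Each coordinate contributes its squared mean [(n f) ^ 2] and the variance
    [n (1 - f ^ 2)]. *)
Lemma walk_mean_sqr n x : walk_mean n (fun u => u.1 ^+ 2 + u.2 ^+ 2) x =
  n%:R ^+ 2 * (f x ^+ 2 + g x ^+ 2) + n%:R * (2 - (f x ^+ 2 + g x ^+ 2)).
Proof.
elim: n => [|n IH].
  by rewrite /walk_mean big_seq1 /= !expr0n /= addr0 mulr0 !mul0r addr0.
have step a b : walk_mean n (fun u => (u + (a, b)).1 ^+ 2 + (u + (a, b)).2 ^+ 2) x =
    walk_mean n (fun u => u.1 ^+ 2 + u.2 ^+ 2) x + 2 * a * (n%:R * f x)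
      + 2 * b * (n%:R * g x) + (a ^+ 2 + b ^+ 2).
  rewrite -walk_mean_fst -walk_mean_snd -!walk_meanZ.
  rewrite -[a ^+ 2 + b ^+ 2 in RHS](walk_mean_cst n _ x) -!walk_meanD.
  by rewrite /walk_mean; apply: eq_bigr => wu _ /=; congr (_ * _); ring.
by rewrite walk_meanS !step IH -natr1; field.
Qed.

Lemma walk_Ck n wu : wu \in walk n -> Ck [:: e1 R; e2 R] 1 wu.1.
Proof.
elim: n wu => [|n IH] wu; first by rewrite inE => /eqP ->; exact: (Ck_cst _ 1 1).
move: IH; rewrite [walk n.+1]/= => IH.
have H a b wu' : wu' \in walk n -> Ck [:: e1 R; e2 R] 1 (branch a b wu').1.
  move=> /IH C; apply: CkM => //.
  have C1 c h : Ck [:: e1 R; e2 R] 1 h -> Ck [:: e1 R; e2 R] 1 (fun x => (1 + c * h x) / 2).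
    by move=> Ch; exact: (CkM (CkD (Ck_cst _ _ 1) (CkZ c Ch)) (Ck_cst _ _ 2^-1)).
  by apply: CkM; exact: C1.
by rewrite !mem_cat => /or4P[] /mapP[wu' /H Hw ->]; exact: Hw.
Qed.

Lemma walk_ge0 n wu x : `|f x| <= 1 -> `|g x| <= 1 -> wu \in walk n -> 0 <= wu.1 x.
Proof.
rewrite !ler_norml => /andP[f1 f2] /andP[g1 g2].
elim: n wu => [|n IH] wu /=; first by rewrite inE => /eqP -> /=.
by rewrite !mem_cat => /or4P[] /mapP[wu' /IH Hw ->] /=; rewrite mulr_ge0 //;
  rewrite mulr_ge0 //; apply: divr_ge0 => //; lra.
Qed.

End Walk.

(** * The perimeter is at most [pi] times the diameter *)

Section PerimeterBound.
Variables (R : realType) (K : set (R * R)) (D : R).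
Hypotheses (bK : bounded_set K) (cK : closed K) (vK : convex_set K).
Hypotheses (D0 : 0 <= D) (DK : forall x y, K x -> K y -> enorm (x - y) <= D).

Local Notation pint h := (\int[@lebesgue2 R]_(x in K) h x).

(** Bounding a length by a quadratic polynomial lets the second moment of the
    walk control the mean length of its end point; near unit length, which is the
    case that matters, little is lost. *)
Lemma enorm_le_sqr (p : R * R) : enorm p <= (1 + (p.1 ^+ 2 + p.2 ^+ 2)) / 2.
Proof.
have -> : p.1 ^+ 2 + p.2 ^+ 2 = enorm p ^+ 2 by rewrite sqr_sqrtr // addr_ge0 ?sqr_ge0.
rewrite -subr_ge0 (_ : _ - _ = (enorm p - 1) ^+ 2 / 2); last by field.
by rewrite divr_ge0 ?sqr_ge0.
Qed.

(** The rescaled end points of the random walk with [n + 1] steps represent the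
    field [(f, g)] exactly as a combination of constant vectors [u i] with smooth
    nonnegative weights [W i], and the mean length of these vectors exceeds 1
    by at most [1 / (n + 1)]. The Crofton bound applies to this decomposition. *)
Lemma pint_divergence_le (f g : R * R -> R) (n : nat) :
  Ck [:: e1 R; e2 R] 1 f -> Ck [:: e1 R; e2 R] 1 g ->
  (forall x, f x ^+ 2 + g x ^+ 2 <= 1) ->
  pint ('D_(e1 R) f) + pint ('D_(e2 R) g) <= pi * D * (1 + n.+1%:R^-1).
Proof.
move=> Cf Cg fg1.
pose s := walk f g n.+1.
pose wu (i : 'I_(size s)) := tnth (in_tuple s) i.
have wus i : wu i \in s by exact: mem_tnth.
pose W i := (wu i).1.
pose N : R := n.+1%:R.
have N0 : N != 0 by rewrite pnatr_eq0.
have Np : 0 < N by rewrite ltr0n.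
pose u i : R * R := ((wu i).2.1 / N, (wu i).2.2 / N).
have CW i : Ck [:: e1 R; e2 R] 1 (W i) by apply: walk_Ck (wus i).
have meanE F x : walk_mean f g n.+1 F x = \sum_i W i x * F (wu i).2.
  by rewrite /walk_mean big_tnth.
have W0 i x : 0 <= W i x.
  apply: walk_ge0 (wus i); rewrite -(@expr_le1 _ 2) // real_normK ?num_real //;
    by apply: le_trans (fg1 x); rewrite ?lerDl ?lerDr sqr_ge0.
have fE : f = fun x => \sum_i (u i).1 * W i x.
  apply/funext => x; rewrite -[LHS](mulKf N0) -(walk_mean_fst f g) meanE mulr_sumr.
  by apply: eq_bigr => i _; rewrite /u /=; field.
have gE : g = fun x => \sum_i (u i).2 * W i x.
  apply/funext => x; rewrite -[LHS](mulKf N0) -(walk_mean_snd f g) meanE mulr_sumr.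
  by apply: eq_bigr => i _; rewrite /u /=; field.
have WM x : K x -> \sum_i enorm (u i) * W i x <= 1 + n.+1%:R^-1.
  move=> _.
  apply: (@le_trans _ _ (\sum_i W i x * ((1 + N ^- 2 * ((wu i).2.1 ^+ 2 + (wu i).2.2 ^+ 2)) / 2))).
    apply: ler_sum => i _; rewrite mulrC ler_wpM2l //.
    apply: le_trans (enorm_le_sqr _) _; rewrite /u /= !expr_div_n -mulrDl [N ^- 2 * _]mulrC.
    exact: lexx.
  rewrite -(meanE (fun u => (1 + N ^- 2 * (u.1 ^+ 2 + u.2 ^+ 2)) / 2)).
  rewrite (_ : (fun u : R * R => _) =
    (fun u => 2^-1 * (1 + N ^- 2 * (u.1 ^+ 2 + u.2 ^+ 2)))); last first.
    by apply/funext => v; rewrite mulrC.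
  rewrite walk_meanZ walk_meanD walk_mean_cst walk_meanZ walk_mean_sqr -/N.
  move: (fg1 x); set t := _ + _ => t1.
  have t0 : 0 <= t by rewrite addr_ge0 ?sqr_ge0.
  rewrite -subr_ge0 (_ : _ - _ = (1 - t) / 2 + t / (2 * N)); last by field.
  by rewrite addr_ge0 ?divr_ge0 ?subr_ge0 ?mulr_ge0 // ltW.
have M0 : 0 <= 1 + n.+1%:R^-1 :> R by rewrite addr_ge0 // invr_ge0.
have := crofton_sum bK cK vK D0 DK CW M0 (fun i x _ => W0 i x) WM.
apply: le_trans.
have dW1 x i : derivable (W i) x (e1 R) by have [] := Ck1_derivable x (CW i).
have dW2 x i : derivable (W i) x (e2 R) by have [] := Ck1_derivable x (CW i).
have c1 i : continuous ('D_(e1 R) (W i)).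
  by have [C1 _] := Ck1_partials (CW i); exact: Ck_continuous C1.
have c2 i : continuous ('D_(e2 R) (W i)).
  by have [_ C2] := Ck1_partials (CW i); exact: Ck_continuous C2.
have Df : 'D_(e1 R) f = fun x => \sum_i (u i).1 * 'D_(e1 R) (W i) x.
  by rewrite {1}fE; apply/funext => x; rewrite derive_lincomb.
have Dg : 'D_(e2 R) g = fun x => \sum_i (u i).2 * 'D_(e2 R) (W i) x.
  by rewrite {1}gE; apply/funext => x; rewrite derive_lincomb.
rewrite Df Dg (pint_sum bK cK (fun i => (u i).1) c1) (pint_sum bK cK (fun i => (u i).2) c2).
by rewrite -big_split.
Qed.

Lemma tv2_indic_le : (tv2 (\1_K : R * R -> R) <= (pi * D)%:E)%E.
Proof.
apply: ge_ereal_sup => _ [phi [[[Cf _] [Cg _]] phi1] <-].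
have [Df _] := Ck1_partials (Cf 1%N); have [_ Dg] := Ck1_partials (Cg 1%N).
have cdiv : continuous (divergence phi) by exact: (Ck_continuous (CkD Df Dg)).
rewrite (integral_indic_plane bK cK cdiv) lee_fin.
have mK := closed_measurable2 cK.
rewrite RintegralD //; last 2 first.
- by apply: integrable_on => //; exact: Ck_continuous Df.
- by apply: integrable_on => //; exact: Ck_continuous Dg.
have fg1 x : (fst \o phi) x ^+ 2 + (snd \o phi) x ^+ 2 <= 1.
  rewrite -[leLHS]sqr_sqrtr ?addr_ge0 ?sqr_ge0 // expr_le1 ?sqrtr_ge0 //.
  exact: phi1.
apply/ler_addgt0Pr => e e0.
have [n] : exists n : nat, pi * D * n.+1%:R^-1 < e.
  have [pD|pD] := leP (pi * D) 0.
    by exists 0%N; rewrite invr1 mulr1 (le_lt_trans pD).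
  have [n _ Hn] := near_infty_natSinv_lt (PosNum (divr_gt0 e0 pD)).
  by exists n; rewrite mulrC -ltr_pdivlMr //; exact: (Hn n (leqnn n)).
move=> /ltW ne; apply: le_trans (pint_divergence_le n (Cf 1%N) (Cg 1%N) fg1) _.
by rewrite mulrDr mulr1 lerD2l.
Qed.

End PerimeterBound.

(** * The Radon transform of the indicator of a convex set *)

Section RadonIndicator.
Variables (R : realType) (K : set (R * R)).
Hypotheses (bK : bounded_set K) (cK : closed K) (vK : convex_set K).
Local Notation line := (measurableTypeR R).
Local Notation plane := (line * line)%type.
Local Notation lambda := (@lebesgue_measure R).
Local Notation chord := (radon (\1_K : R * R -> R)).

Lemma integral_slice_cst theta s (c : R) :
  (\int[lambda]_t (\1_K (rot theta (s, t)) * c)%:E =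
   \int[lambda]_(t in [set t | K (rot theta (s, t))]) c%:E)%E.
Proof. exact: (integral_indicM lambda [set t | K (rot theta (s, t))] (fun=> c)). Qed.

(** By convexity a line meets the set in a segment or not at all. *)
Lemma chordE theta s : circle theta ->
  ((forall t, ~ K (rot theta (s, t))) /\ chord s theta = 0) \/
  exists a b, [/\ a <= b, [set t | K (rot theta (s, t))] = `[a, b]%classic &
    chord s theta = b - a].
Proof.
move=> ct.
have chE : chord s theta =
    fine (\int[lambda]_(t in [set t | K (rot theta (s, t))]) 1%:E)%E.
  rewrite -integral_slice_cst /radon /Rintegral; congr fine.
  by apply: eq_integral => t _; rewrite mulr1.
have [neS|/forallNP S0] := pselect (exists t, K (rot theta (s, t))); last first.
  left; split => //; rewrite chE (_ : [set t | K (rot theta (s, t))] = set0) ?integral_set0 //.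
  by apply/seteqP; split => // t; exact: S0.
right; have [a [b [ab Sab]]] := slice_interval bK cK vK ct neS.
by exists a, b; rewrite chE Sab integral_cst_itv // mul1r.
Qed.

Lemma integral_slice theta s (c : R) : circle theta ->
  (\int[lambda]_t (\1_K (rot theta (s, t)) * c)%:E = (chord s theta * c)%:E)%E.
Proof.
move=> ct; rewrite integral_slice_cst.
have [[S0 ->]|[a [b [ab -> ->]]]] := chordE s ct.
  rewrite (_ : [set t | K (rot theta (s, t))] = set0) ?integral_set0 ?mul0r //.
  by apply/seteqP; split => // t; exact: S0.
by rewrite integral_cst_itv // mulrC.
Qed.

Lemma chord_ge theta s t1 t2 : circle theta -> t1 <= t2 ->
  K (rot theta (s, t1)) -> K (rot theta (s, t2)) -> t2 - t1 <= chord s theta.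
Proof.
move=> ct t12 K1 K2; have [[S0 _]|[a [b [ab Sab ->]]]] := chordE s ct.
  by case: (S0 t1).
have : `[a, b]%classic t1 by rewrite -Sab.
have : `[a, b]%classic t2 by rewrite -Sab.
by rewrite /= !in_itv /= => /andP[_ b2] /andP[a1 _]; exact: lerB.
Qed.

Lemma measurable_chord theta : circle theta ->
  measurable_fun setT (fun s : line => chord s theta : line).
Proof.
move=> ct.
have /measurable_EFinP : measurable_fun setT (fun s : line => (chord s theta)%:E); last by [].
have c1 : continuous (fun _ : R * R => 1 : R) by exact: cst_continuous.
have := measurable_int _ (integrable_fubini_F (integrable_rot ct bK cK c1)).
apply: eq_measurable_fun => s _.
by rewrite /fubini_F /= integral_slice // mulr1.
Qed.

Lemma chord_bounded theta : circle theta ->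
  exists B, forall s t, K (rot theta (s, t)) -> `|s| <= B.
Proof.
move=> ct; have [M M0 KM] := bounded_box bK.
exists (M + M) => s t /KM.
have [] := rot_coords (s, t) ct; rewrite [(s, t).1]/= [(s, t).2]/=.
set p := rot _ _ => s2 _ [p1 p2].
rewrite s2 (le_trans (ler_normD _ _)) // !normrM.
have [h1 h2] := circle_le1 ct.
by apply: lerD; rewrite -[leRHS]mul1r ler_pM.
Qed.

Lemma test1_support (phi : R -> R) (A : R) : (forall k, Ck [:: 1 : R] k phi) ->
  (forall x, A < `|x| -> phi x = 0) -> test1 phi.
Proof.
move=> Cphi phi0; split => //.
apply: (subclosed_compact (@closed_closure _ _) (@segment_compact R (- A) A)).
have /closure_id E : closed (`[- A, A]%classic : set R) by exact: interval_closed.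
rewrite [X in _ `<=` X]E; apply: closure_subset => x /=; apply: contraNT.
by rewrite in_itv /= -ler_norml -ltNge => /phi0 ->.
Qed.

(** By convexity the chords at the offsets within the fraction [e] of the way
    from [s0] to [s1] are at least [(1 - e)] times as long as the one at [s0]. *)
Lemma chord_cone theta (s0 s1 t1 t2 t3 e x : R) : circle theta ->
  s0 < s1 -> t1 <= t2 ->
  K (rot theta (s0, t1)) -> K (rot theta (s0, t2)) -> K (rot theta (s1, t3)) ->
  e <= 1 -> s0 <= x <= s0 + e * (s1 - s0) ->
  (1 - e) * (t2 - t1) <= chord x theta.
Proof.
move=> ct s01 t12 K1 K2 K3 e1 /andP[x0 x1].
have s10 : 0 < s1 - s0 by rewrite subr_gt0.
pose l := (x - s0) / (s1 - s0).
have l0 : 0 <= l by rewrite divr_ge0 ?subr_ge0 // ltW.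
have le : l <= e by rewrite ler_pdivrMr // lerBlDl.
have l1 : 0 <= 1 - l by rewrite subr_ge0 (le_trans le).
have l1' : 1 - l <= 1 by rewrite gerBl.
have xl : (1 - l) * s0 + l * s1 = x by rewrite /l; field; rewrite gt_eqF.
have cone t : K (rot theta (s0, t)) -> K (rot theta (x, (1 - l) * t + l * t3)).
  move=> Kt; have := convex_setE vK Kt K3 l1 l1'.
  rewrite opprB addrCA subrr addr0; congr K.
  rewrite -xl !rotE; case: theta {ct K1 K2 K3 Kt} => c d /=; congr pair.
    change ((1 - l) * (c * s0 - d * t) + l * (c * s1 - d * t3) =
      c * ((1 - l) * s0 + l * s1) - d * ((1 - l) * t + l * t3)); ring.
  by change ((1 - l) * (d * s0 + c * t) + l * (d * s1 + c * t3) =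
    d * ((1 - l) * s0 + l * s1) + c * ((1 - l) * t + l * t3)); ring.
apply: (@le_trans _ _ ((1 - l) * (t2 - t1))).
  by rewrite ler_wpM2r ?subr_ge0 // lerD2l lerN2.
have := chord_ge ct _ (cone _ K1) (cone _ K2).
rewrite lerD2r ler_wpM2l // => /(_ isT); apply: le_trans.
by rewrite opprD addrACA subrr addr0 mulrBr.
Qed.

(** The test function climbs from -1 to 1 while the offset runs through the
    first fraction [e] of the way from [s0] to [s1]; it returns to 0 on both
    sides at offsets where no line meets the set. *)
Lemma chord_le_tv1 theta (s0 s1 t1 t2 t3 e : R) : circle theta ->
  s0 < s1 -> t1 <= t2 ->
  K (rot theta (s0, t1)) -> K (rot theta (s0, t2)) -> K (rot theta (s1, t3)) ->
  0 < e -> e <= 1 ->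
  ((2 * ((1 - e) * (t2 - t1)))%:E <= tv1 (chord^~ theta))%E.
Proof.
move=> ct s01 t12 K1 K2 K3 e0 e1.
have [B KB] := chord_bounded ct.
have [eta [Ceta eta01 eta1 etaB]] := plateau (B + 1).
pose s2 := s0 + e * (s1 - s0).
have s02 : s0 < s2 by rewrite ltrDl mulr_gt0 ?subr_gt0.
pose h := ramp s0 s2.
have [dh ch] := Ck1_derive1 (Ck_ramp s0 s2 1).
(* No line with an offset beyond [B] meets [K], so [eta] only affects offsets
   where the chord is empty. *)
pose phi (x : R) : R := (2 * h x + -1) * eta x.
have Cphi k : Ck [:: 1 : R] k phi.
  exact: (CkM (CkD (CkZ 2 (Ck_ramp s0 s2 k)) (Ck_cst _ k (-1))) (Ceta k)).
have phi1 x : `|phi x| <= 1.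
  have /andP[a0 a1] := ramp01 s0 s2 x; have /andP[b0 b1] := eta01 x.
  rewrite normrM (ger0_norm b0) mulr_ile1 // ler_norml.
  by apply/andP; split; rewrite -/(h x) in a0 a1 *; lra.
have Dphi (x : R) : `|x| <= B -> 'D_1 phi x = 2 * 'D_1 h x.
  move=> xB.
  have <- : 'D_1 (2 \*: h + cst (-1)) x = 2 * 'D_1 h x.
    by rewrite deriveD ?derive_cst ?addr0 ?deriveZ //; exact: derivableZ.
  apply: near_eq_derive; near=> y.
  rewrite /phi eta1 ?mulr1 // ltW //; near: y.
  by apply: (cvgr_lt `|x|); [exact: norm_continuous | rewrite (le_lt_trans xB) ?ltrDl].
pose c := (1 - e) * (t2 - t1).
have c0 : 0 <= c by rewrite mulr_ge0 ?subr_ge0.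
have Dh_ge0 (x : R) : 0 <= 'D_1 h x := derive_ramp_ge0 s02 x.
have D_ge0 x : 0 <= c * (2 * 'D_1 h x) by apply: mulr_ge0 => //; exact: mulr_ge0.
have pointwise (x : R) : c * (2 * 'D_1 h x) <= chord x theta * 'D_1 phi x.
  have [xs|/(derive_ramp_out s02) D0] := boolP (s0 <= x <= s2).
    have xB : `|x| <= B.
      have := KB _ _ K1; have := KB _ _ K3; rewrite !ler_norml.
      have s21 : s2 <= s1 by rewrite -lerBrDl -[leRHS]mul1r ler_wpM2r // subr_ge0 ltW.
      move: xs => /andP[x0 x2] /andP[_ s1B] /andP[Bs0 _].
      by rewrite (le_trans Bs0) //= (le_trans x2) // (le_trans s21).
    rewrite Dphi //; apply: ler_wpM2r; first exact: mulr_ge0.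
    exact: (chord_cone ct s01 t12 K1 K2 K3 e1 xs).
  rewrite D0 // !mulr0; have [[_ ->]|[a [b [ab Sab _]]]] := chordE x ct.
    by rewrite mul0r.
  have : `[a, b]%classic a by rewrite /= in_itv /= lexx ab.
  by rewrite -Sab => /KB xB; rewrite Dphi // D0 // !mulr0.
have mD : measurable_fun setT (fun x : R => (c * (2 * 'D_1 h x))%:E).
  apply/measurable_EFinP; do 2 apply: measurable_funM => //.
  exact: continuous_measurable_fun.
apply: (@le_trans _ _ (\int[lambda]_x (chord x theta * 'D_1 phi x)%:E)%E); last first.
  apply: ereal_sup_ubound; exists phi => //; split => //.
  by apply: (test1_support Cphi) => x /etaB; rewrite /phi => ->; rewrite mulr0.
have le1 : (\int[lambda]_x (c * (2 * 'D_1 h x))%:E <=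
    \int[lambda]_x (chord x theta * 'D_1 phi x)%:E)%E.
  apply: ge0_le_integral => //.
  - by move=> x _; rewrite lee_fin.
  - apply/measurable_EFinP.
    have [_ cphi] := Ck1_derive1 (Cphi 1%N).
    exact: (measurable_funM (measurable_chord ct) (continuous_measurable_fun cphi)).
  - by move=> x _; rewrite lee_fin.
apply: le_trans le1.
have le2 : (\int[lambda]_(x in `[s0, s2]) (c * (2 * 'D_1 h x))%:E <=
    \int[lambda]_x (c * (2 * 'D_1 h x))%:E)%E.
  by apply: ge0_subset_integral => // x _; rewrite lee_fin.
apply: le_trans le2.
have Dc (x : R) : is_derive x 1 (c \*: (2 \*: h)) (c * (2 * 'D_1 h x)).
  by apply: is_deriveZ; apply: is_deriveZ; exact: derivableP.
rewrite (integral_derive (ltW s02) Dc) /=.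
  rewrite /h (ramp_0 s02 (lexx s0)) (ramp_1 s02 (lexx s2)) !scaler0 subr0 /c.
  by rewrite [2 *: 1]mulr1 [_ *: 2]mulrC.
have C0 : Ck [:: 1 : R] 0 ('D_1 h) by split.
exact: (Ck_continuous (CkZ c (CkZ 2 C0))).
Unshelve. all: by end_near. Qed.

End RadonIndicator.

(** * The variation of the Radon transform is at least twice the diameter *)

Section DiameterBound.
Variables (R : realType) (K : set (R * R)).
Hypotheses (bK : bounded_set K) (cK : closed K) (vK : convex_set K).
Hypothesis K0 : (0 < @lebesgue2 R K)%E.
Local Notation line := (measurableTypeR R).
Local Notation plane := (line * line)%type.
Local Notation lambda := (@lebesgue_measure R).
Local Notation chord := (radon (\1_K : R * R -> R)).

Lemma rot_coordsK (theta p : R * R) : circle theta ->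
  rot theta (theta.1 * p.1 + theta.2 * p.2, theta.1 * p.2 - theta.2 * p.1) = p.
Proof.
move=> /circleP; case: theta p => c d [x y] /= ct; rewrite rotE /=; congr pair.
  by rewrite -[RHS]mul1r -ct; ring.
by rewrite -[RHS]mul1r -ct; ring.
Qed.

(** A set contained in a line has measure zero. *)
Lemma not_in_line theta s0 : circle theta ->
  exists s t, K (rot theta (s, t)) /\ s != s0.
Proof.
move=> ct; apply: contrapT => H.
have KS s t : K (rot theta (s, t)) -> s = s0.
  move=> Kst; apply: contrapT => /eqP ns; apply: H; by exists s, t.
suff : @lebesgue2 R K = 0%E by move=> K0'; move: K0; rewrite K0' ltxx.
have mK := closed_measurable2 cK.
rewrite -((area_preserving_rot ct).2 _ mK).
have m1 : measurable ([set s0] : set line) by exact: measurable_set1.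
apply/eqP; rewrite eq_le measure_ge0 andbT.
apply: (@le_trans _ _ (@lebesgue2 R ([set s0] `*` setT))).
  apply: le_measure; rewrite ?inE.
  - exact: measurable_rot_preimage.
  - exact: measurableX.
  - by move=> [s t] /= /KS ->.
have -> : @lebesgue2 R ([set s0] `*` setT) = (lambda [set s0] * lambda setT)%E.
  exact: product_measure1E.
by rewrite lebesgue_measure_set1 mul0e.
Qed.

Lemma tv1_ge0 (g : R -> R) : (0 <= tv1 g)%E.
Proof.
apply: ereal_sup_ubound; exists (fun=> 0); last first.
  by rewrite (eq_integral (cst 0%E)) ?integral0 // => x _; rewrite derive_cst mulr0.
split; last by move=> x; rewrite normr0.
apply: (@test1_support _ _ 0) => //.
by move=> k; exact: Ck_cst.
Qed.

Lemma chord_le_rtv_dir theta s0 s1 t1 t2 t3 : circle theta -> s0 != s1 -> t1 <= t2 ->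
  K (rot theta (s0, t1)) -> K (rot theta (s0, t2)) -> K (rot theta (s1, t3)) ->
  ((2 * (t2 - t1))%:E <= rtv chord)%E.
Proof.
(* Replacing [theta] by its opposite reverses the order of the offsets. *)
wlog s01 : theta s0 s1 t1 t2 t3 / s0 < s1.
  move=> H ct; rewrite neq_lt => /orP[s01|s10] t12 K1 K2 K3.
    by apply: (H theta s0 s1 t1 t2 t3) => //; rewrite lt_eqF.
  have E s t : rot (- theta.1, - theta.2) (- s, - t) = rot theta (s, t).
    by rewrite !rotE /=; congr pair; ring.
  have ct' : circle (- theta.1, - theta.2).
    by move/circleP : ct => ct; apply/circleP; rewrite /= !sqrrN.
  have s10' : - s0 < - s1 by rewrite ltrN2.
  have := H _ _ _ (- t2) (- t1) (- t3) s10' ct'.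
  rewrite !E lerN2 lt_eqF // => /(_ isT t12 K2 K1 K3).
  by rewrite opprK addrC.
move=> ct _ t12 K1 K2 K3; apply/lee_addgt0Pr => e e0.
pose d := t2 - t1.
have d0 : 0 <= d by rewrite subr_ge0.
(* Chosen to make the loss [2 * e' * d] at most [e]. *)
pose e' := Num.min (2^-1) (e / (2 * d + 1)).
have n0 : 0 < 2 * d + 1 by rewrite ltr_wpDl // mulr_ge0.
have e'0 : 0 < e' by rewrite lt_min invr_gt0 ltr0n divr_gt0.
have e'1 : e' < 1 by rewrite gt_min invf_lt1 ?ltr1n.
have H := chord_le_tv1 bK cK vK ct s01 t12 K1 K2 K3 e'0 (ltW e'1).
apply: (@le_trans _ _ ((2 * ((1 - e') * d))%:E + e%:E)%E).
  rewrite -EFinD lee_fin -/d.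
  have : e' * (2 * d) <= e.
    apply: (@le_trans _ _ (e / (2 * d + 1) * (2 * d))).
      by rewrite ler_wpM2r ?mulr_ge0 // ge_min lexx orbT.
    by rewrite mulrAC ler_pdivrMr // ler_pM2l // lerDl.
  by lra.
apply: leeD => //; apply: (le_trans H).
by apply: ereal_sup_ubound; exists theta.
Qed.

(** Two points of the set span a chord; the lines parallel to it are the ones
    along which the Radon transform is taken. *)
Lemma diameter_le_rtv x y : K x -> K y -> ((2 * enorm (x - y))%:E <= rtv chord)%E.
Proof.
move=> Kx Ky; have [xy0|xy0] := eqVneq (enorm (x - y)) 0.
  rewrite xy0 mulr0; apply: (le_trans (tv1_ge0 (chord^~ (1, 0)))).
  apply: ereal_sup_ubound; exists (1, 0) => //.
  by apply/circleP; rewrite /= expr1n expr0n addr0.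
set l := enorm (x - y) in xy0 *.
have lE : l ^+ 2 = (x - y).1 ^+ 2 + (x - y).2 ^+ 2 by rewrite sqr_sqrtr // addr_ge0 ?sqr_ge0.
(* The quarter turn of the unit vector along [x - y]. *)
pose theta : R * R := ((x - y).2 / l, - (x - y).1 / l).
have ct : circle theta.
  by apply/circleP; rewrite /theta /= !expr_div_n sqrrN -mulrDl addrC -lE divff ?expf_neq0.
have := rot_coordsK x ct; have := rot_coordsK y ct.
set s := theta.1 * x.1 + _; set t := theta.1 * x.2 - _.
set s' := theta.1 * y.1 + _; set t' := theta.1 * y.2 - _.
move=> Ey Ex.
have ss' : s' = s.
  by rewrite /s /s' /theta /=; field.
have tt' : t - t' = l.
  have -> : t - t' = ((x - y).1 ^+ 2 + (x - y).2 ^+ 2) / l by rewrite /t /t' /theta /=; field.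
  by rewrite -lE expr2 mulfK.
have [s1 [t1 [K1 ns]]] := not_in_line s ct.
rewrite -tt'; apply: (chord_le_rtv_dir (s0 := s) (s1 := s1) (t3 := t1) ct) => //.
- by rewrite eq_sym.
- by rewrite -subr_ge0 tt' sqrtr_ge0.
- by rewrite -ss' Ey.
- by rewrite Ex.
Qed.

End DiameterBound.

(** * Plane waves *)

Section PlaneWaves.
Variables (R : realType) (K : set (R * R)).
Hypotheses (bK : bounded_set K) (cK : closed K) (vK : convex_set K).
Local Notation lambda := (@lebesgue_measure R).
Local Notation chord := (radon (\1_K : R * R -> R)).

Definition dot (a b : R) (x : R * R) : R := a * x.1 + b * x.2.

Lemma dot_continuous a b : continuous (dot a b).
Proof.
case=> x y; apply: (@continuousD _ _ _ (fun p : R * R => a * p.1) (fun p => b * p.2));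
  apply: continuousM; try exact: cst_continuous.
  exact: cvg_fst.
exact: cvg_snd.
Qed.

Lemma dotE a b h (x e : R * R) : dot a b (h *: e + x) = h * dot a b e + dot a b x.
Proof.
case: x e => x1 x2 [y1 y2].
change (a * (h * y1 + x1) + b * (h * y2 + x2) = h * (a * y1 + b * y2) + (a * x1 + b * x2)).
ring.
Qed.

Lemma Ck_plane_wave (g : R -> R) a b k : Ck [:: 1 : R] k g ->
  Ck [:: e1 R; e2 R] k (fun x => g (dot a b x)).
Proof. exact: (Ck_comp_affine (@dot_continuous a b) (@dotE a b)). Qed.

Lemma is_derive_plane_wave (g : R -> R) a b x e : Ck [:: 1 : R] 1 g ->
  is_derive x e (fun x => g (dot a b x)) (dot a b e * 'D_1 g (dot a b x)).
Proof.
by move=> /Ck1_derive1[dg _]; exact: (is_derive_comp_affine (@dotE a b) e (dg _)).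
Qed.

Lemma test_support_compact (f : R * R -> R) (A : R) :
  (forall x, f x != 0 -> `|x.1| <= A /\ `|x.2| <= A) ->
  compact (closure [set x | f x != 0]).
Proof.
move=> fA; pose I : set R := `[- A, A]%classic.
have cI : closed I by exact: interval_closed.
have kI : compact (I `*` I) by apply: compact_setX; exact: segment_compact.
have /closure_id E : closed (I `*` I).
  by apply: compact_closed kI; exact: norm_hausdorff.
apply: (subclosed_compact (@closed_closure _ _) kI).
rewrite E; apply: closure_subset => x /fA[x1 x2].
by split; rewrite /I /= in_itv /= -ler_norml.
Qed.

Lemma test1_bounded (phi : R -> R) : test1 phi ->
  exists2 A, 0 < A & forall x, phi x != 0 -> `|x| <= A.
Proof.
move=> [_ /compact_bounded/ex_strict_bound_gt0[A A0 hA]].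
by exists A => // x x0; apply/ltW/hA; exact: subset_closure.
Qed.

(** The competitor in the plane is the plane wave [phi (x . theta) theta], cut off
    in the direction of the wave fronts: the derivative of the cutoff, being along
    the fronts, does not enter the divergence. *)
Lemma tv1_chord_le_tv2 theta : circle theta ->
  (tv1 (chord^~ theta) <= tv2 (\1_K : R * R -> R))%E.
Proof.
move=> ct; apply: ge_ereal_sup => _ [phi [tphi phi1] <-].
have [Cphi _] := tphi.
have [A A0 phiA] := test1_bounded tphi.
have [M M0 KM] := bounded_box bK.
have [eta [Ceta eta01 eta1 eta0]] := plateau (M + M).
have ct1 := (circleP theta).1 ct.
have [h1 h2] := circle_le1 ct.
pose B := M + M + 1.
pose L1 := dot theta.1 theta.2; pose L2 := dot (- theta.2) theta.1.
pose wave (x : R * R) := phi (L1 x) * eta (L2 x).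
pose Phi (x : R * R) : R * R := (theta.1 * wave x, theta.2 * wave x).
have Cwave k : Ck [:: e1 R; e2 R] k wave.
  by apply: CkM; exact: Ck_plane_wave.
have wave_supp x : wave x != 0 -> `|x.1| <= A + B /\ `|x.2| <= A + B.
  rewrite mulf_eq0 negb_or => /andP[/phiA x1 x2].
  have {}x2 : `|L2 x| <= B.
    by move: x2; apply: contraNT; rewrite -ltNge => /eta0 ->.
  have E1 : x.1 = theta.1 * L1 x - theta.2 * L2 x.
    by rewrite /L1 /L2 /dot -[LHS]mul1r -ct1; ring.
  have E2 : x.2 = theta.2 * L1 x + theta.1 * L2 x.
    by rewrite /L1 /L2 /dot -[LHS]mul1r -ct1; ring.
  rewrite E1 E2; split; [apply: (le_trans (ler_normB _ _)) | apply: (le_trans (ler_normD _ _))];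
    rewrite !normrM; apply: lerD; rewrite -[leRHS]mul1r; exact: ler_pM.
have tPhi : test2 Phi.
  split; split; try by move=> k; exact: CkZ.
    apply: (@test_support_compact _ (A + B)) => x /= wx; apply: wave_supp.
    by move: wx; apply: contraNneq => ->; rewrite mulr0.
  apply: (@test_support_compact _ (A + B)) => x /= wx; apply: wave_supp.
  by move: wx; apply: contraNneq => ->; rewrite mulr0.
have Phi1 x : enorm (Phi x) <= 1.
  have E z : enorm (theta.1 * z, theta.2 * z) = `|z|.
    by rewrite /enorm /= !exprMn -mulrDl ct1 mul1r sqrtr_sqr.
  rewrite /Phi E normrM.
  have /andP[e0 e1] := eta01 (L2 x).
  by rewrite -[leRHS]mul1r ler_pM // ger0_norm.
have [_ cphi] := Ck1_derive1 (Cphi 1%N).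
pose h x := 'D_1 phi (L1 x).
have ch : continuous h.
  by move=> x; apply: (@continuous_comp _ _ _ L1 ('D_1 phi)); [exact: dot_continuous | exact: cphi].
have divE x : divergence Phi x = h x * eta (L2 x).
  have dw e : is_derive x e wave _ :=
    is_deriveM (is_derive_plane_wave theta.1 theta.2 x e (Cphi 1%N))
      (is_derive_plane_wave (- theta.2) theta.1 x e (Ceta 1%N)).
  have [_ E1] := is_deriveZ theta.1 (dw (e1 R)).
  have [_ E2] := is_deriveZ theta.2 (dw (e2 R)).
  rewrite /divergence.
  rewrite -[X in X + _]/('D_(e1 R) (theta.1 \*: wave) x).
  rewrite -[X in _ + X]/('D_(e2 R) (theta.2 \*: wave) x) E1 E2.
  rewrite -/(L1 x) -/(L2 x) -/(h x) /dot /e1 /e2 /GRing.scale /= !mulr0 !mulr1 addr0 add0r addr0 add0r.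
  transitivity ((theta.1 ^+ 2 + theta.2 ^+ 2) * (h x * eta (L2 x))); last by rewrite ct1 mul1r.
  ring.
have -> : (\int[lambda]_s (chord s theta * 'D_1 phi s)%:E =
    \int[@lebesgue2 R]_x (\1_K x * divergence Phi x)%:E)%E.
  transitivity (\int[@lebesgue2 R]_x (\1_K x * h x)%:E)%E; last first.
    apply: eq_integral => x _; rewrite divE indicE.
    have [/set_mem Kx|_] := boolP (x \in K); last by rewrite !mul0r.
    rewrite eta1 ?mulr1 //; have [x1 x2] := KM x Kx.
    rewrite /L2 /dot (le_trans (ler_normD _ _)) // !normrM normrN.
    by apply: lerD; rewrite -[leRHS]mul1r ler_pM.
  rewrite (integral_rot ct bK cK ch); apply: eq_integral => s _.
  rewrite -(integral_slice bK cK vK s ('D_1 phi s) ct).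
  apply: eq_integral => t _; congr (_ * _)%:E; rewrite /h; congr ('D_1 phi _).
  by have [E _] := rot_coords (s, t) ct; exact/esym.
by apply: ereal_sup_ubound; exists Phi.
Qed.

Lemma rtv_chord_le_tv2 : (rtv chord <= tv2 (\1_K : R * R -> R))%E.
Proof. by apply: ge_ereal_sup => _ [theta ct <-]; exact: tv1_chord_le_tv2. Qed.

End PlaneWaves.

(** * The theorem *)

Theorem theorem4 (R : realType) (K : set (R * R)) :
  bounded_set K -> closed K -> convex_set K -> (0 < @lebesgue2 R K)%E ->
  let f : R * R -> R := \1_K in
  ((2 / pi)%:E * tv2 f <= rtv (radon f))%E /\ (rtv (radon f) <= tv2 f)%E.
Proof.
move=> bK cK vK K0 f; split; last exact: rtv_chord_le_tv2.
have diam := diameter_le_rtv bK cK vK K0.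
have rtv_ge0 : (0 <= rtv (radon f))%E.
  have [x Kx] : K !=set0.
    by apply/set0P/negP => /eqP KE; move: K0; rewrite KE measure0 ltxx.
  by apply: le_trans (diam _ _ Kx Kx); rewrite lee_fin mulr_ge0 ?enorm_ge0.
have [->|rtv_fin] := eqVneq (rtv (radon f)) +oo%E; first exact: leey.
have rtvE : rtv (radon f) = (fine (rtv (radon f)))%:E.
  by rewrite fineK // ge0_fin_numE // lt_neqAle rtv_fin leey.
pose D := fine (rtv (radon f)) / 2.
have D0 : 0 <= D by rewrite divr_ge0 ?fine_ge0.
have DK x y : K x -> K y -> enorm (x - y) <= D.
  by move=> Kx Ky; rewrite ler_pdivlMr // mulrC -lee_fin -rtvE; exact: diam.
apply: (@le_trans _ _ ((2 / pi)%:E * (pi * D)%:E)%E).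
  apply: lee_wpmul2l; first by rewrite lee_fin divr_ge0 ?pi_ge0.
  exact: tv2_indic_le bK cK vK D0 DK.
rewrite rtvE -EFinM lee_fin le_eqVlt; apply/orP; left; apply/eqP.
by rewrite /D; have := pi_gt0 R; move: (pi : R) => p p0; field; rewrite gt_eqF.
Qed.
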